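(* Let $d\in\{1,2\}$. There exists an absolute constant $c>0$ such that for all $T>0$ and all Borel $V:\mathbb{R}^d\to\mathbb{R}$, $$c^{-1}\sup_{x\in\mathbb{R}^d}\int_0^T\int_{\mathbb{R}^d}g(s,x,z)|V(z)|\,dz\,ds\le\|S(V)\|_{T,\infty}\le c\sup_{x\in\mathbb{R}^d}\int_0^T\int_{\mathbb{R}^d}g(s,x,z)|V(z)|\,dz\,ds.$$
   Context: $g(t,x,y)=(4\pi t)^{-d/2}e^{-|y-x|^2/(4t)}$. $S(V,t,x,y)=\int_0^t\int_{\mathbb{R}^d}\frac{g(s,x,z)g(t-s,z,y)}{g(t,x,y)}|V(z)|\,dz\,ds$, $\|S(V,t)\|_\infty=\sup_{x,y\in\mathbb{R}^d}S(V,t,x,y)$, $\|S(V)\|_{T,\infty}=\sup_{0<t\le T}\|S(V,t)\|_\infty$. *)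

(* Defs.v *)
From mathcomp Require Import all_boot all_order all_algebra.
From mathcomp Require Import all_classical all_reals all_analysis.
Set Implicit Arguments. Unset Strict Implicit. Unset Printing Implicit Defensive.
Import Order.TTheory GRing.Theory Num.Theory.
Local Open Scope classical_set_scope.
Local Open Scope ring_scope.

(* Lebesgue integral over R^d of a nonnegative extended-real function,
   written as the iterated one-dimensional Lebesgue integral
   (coincides with the d-dimensional Lebesgue integral by Tonelli). *)
Fixpoint intRd {R : realType} (n : nat) : ('rV[R]_n -> \bar R) -> \bar R :=
  match n return ('rV[R]_n -> \bar R) -> \bar R with
  | 0 => fun f => f 0
  | n'.+1 => fun f =>
      (\int[@lebesgue_measure R]_(a in [set: R])
         @intRd R n' (fun v : 'rV[R]_n' => f (row_mx (const_mx a : 'rV[R]_1) v)))%E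
  end.

(* Borel sigma-algebra on R^d: generated by the coordinate preimages of
   Borel subsets of R (= product Borel sigma-algebra = Borel sets of R^d). *)
Definition borel_Rd {R : realType} (d : nat) : set (set 'rV[R]_d) :=
  <<s [set A | exists (i : 'I_d) (B : set R), measurable B /\
                 A = [set x : 'rV[R]_d | B (x ord0 i)]] >>.

Definition borel_fun {R : realType} (d : nat) (V : 'rV[R]_d -> R) : Prop :=
  forall B : set R, measurable B -> @borel_Rd R d (V @^-1` B).

Definition sqdist {R : realType} (d : nat) (x y : 'rV[R]_d) : R :=
  \sum_(i < d) (y ord0 i - x ord0 i) ^+ 2.

Definition gauss {R : realType} (d : nat) (t : R) (x y : 'rV[R]_d) : R :=
  powR (4 * pi * t) (- (d%:R / 2)) * expR (- (sqdist x y / (4 * t))).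

Definition Sfun {R : realType} (d : nat) (V : 'rV[R]_d -> R) (t : R)
    (x y : 'rV[R]_d) : \bar R :=
  (\int[@lebesgue_measure R]_(s in `]0%R, t[%classic)
     intRd (fun z => ((gauss s x z * gauss (t - s) z y / gauss t x y)
                       * `|V z|)%:E))%E.

Definition Snorm {R : realType} (d : nat) (V : 'rV[R]_d -> R) (T : R) : \bar R :=
  ereal_sup [set r | exists (t : R) (x y : 'rV[R]_d),
     `]0%R, T]%classic t /\ r = Sfun V t x y].

Definition Kato {R : realType} (d : nat) (V : 'rV[R]_d -> R) (T : R) : \bar R :=
  ereal_sup [set (\int[@lebesgue_measure R]_(s in `]0%R, T[%classic)
                    intRd (fun z => (gauss s x z * `|V z|)%:E))%E
            | x in [set: 'rV[R]_d]].

(* Main.v *)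
(*
  Lower bound.  Integrating the bridge integral S(V,T,x,y) against g(T,x,y) dy
  gives exactly the Kato integral at x, because g(T-s,z,.) has mass one.

  Upper bound.  For s <= t/2 the bridge density is at most 2 g(s, x + s v, z) with
  v = (y-x)/t, and the times s >= t/2 follow by reversing the bridge.  Put
  r = |z-x|, a = |v|.  If r a <= 2, then g(s, x + s v, z) <= e g(s, x, z), which
  the Kato integral controls.  If r a > 2, use g(s, ., .) <= (t/s) (4 pi t)^(-d/2)
  exp(-|.|^2/(4s)) (here d <= 2) and cut the time interval into pieces
  [k h, (k+1) h[ with h = sqrt t / a.  On each piece the ray moves by at most
  sqrt t, so half of the exponent is dominated by a Gaussian window of width
  sqrt t around x + k h v; such a window carries mass at most a constant times
  the Kato bound, divided by t g(t,0,0).  The other half leaves the time integral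
  of s^-1 exp(-(r - s a)^2/(8s)), at most 8 pi for k = 0 and 16 pi / (a sqrt (k h))
  for k > 0; with about t/h pieces these numbers add up to at most 40 pi.
*)
From HB Require Import structures.
Require Import Defs.
From mathcomp Require Import all_boot all_order all_algebra.
From mathcomp Require Import all_classical all_reals all_analysis.
From mathcomp Require Import measurable_realfun lebesgue_integral_fubini.
From mathcomp Require Import ring lra.
Import Order.TTheory GRing.Theory Num.Theory.
Import numFieldNormedType.Exports.
Local Open Scope classical_set_scope.
Local Open Scope ring_scope.

(** * Heat kernels and bridges *)

Section sqdist.
Context {R : realType} {d : nat}.
Implicit Types (x y z v : 'rV[R]_d) (s t : R).

Lemma sqdist_ge0 x y : 0 <= sqdist x y.
Proof. by apply: sumr_ge0 => i _; exact: sqr_ge0. Qed.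

Lemma sqdistC x y : sqdist x y = sqdist y x.
Proof. by apply: eq_bigr => i _; rewrite -sqrrN opprB. Qed.

Lemma sqdist_quasi_triangle z x y :
  sqdist x y <= 2 * sqdist x z + 2 * sqdist z y.
Proof.
rewrite /sqdist !mulr_sumr -big_split /=; apply: ler_sum => i _.
have := sqr_ge0 (z ord0 i - x ord0 i - (y ord0 i - z ord0 i)); nra.
Qed.

Lemma sqdist_ray x v s s' :
  sqdist (x + s *: v) (x + s' *: v) = (s' - s) ^+ 2 * sqdist 0 v.
Proof.
by rewrite /sqdist mulr_sumr; apply: eq_bigr => i _; rewrite !mxE; ring.
Qed.

Lemma sqdist_eq0 x y : sqdist x y = 0 -> y = x.
Proof.
move=> /eqP; rewrite psumr_eq0 => [|i _]; last exact: sqr_ge0.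
move=> /allP xy; apply/rowP => i; apply/eqP; rewrite -subr_eq0 -sqrf_eq0.
by have := xy i (mem_index_enum _).
Qed.

(** Squared reverse triangle inequality for [z - x] and [s *: v]. It replaces the position of [z] by
    its radius, so that the later time integrals depend only on [r] and [a]. *)
Lemma sqdist_to_ray_ge x v z s : 0 <= s ->
  (Num.sqrt (sqdist x z) - s * Num.sqrt (sqdist 0 v)) ^+ 2 <=
  sqdist (x + s *: v) z.
Proof.
move=> s0; set r := Num.sqrt (sqdist x z); set a := Num.sqrt (sqdist 0 v).
have r0 : 0 <= r by exact: sqrtr_ge0.
have a0 : 0 <= a by exact: sqrtr_ge0.
have r2 : r ^+ 2 = sqdist x z by rewrite sqr_sqrtr// sqdist_ge0.
have a2 : a ^+ 2 = sqdist 0 v by rewrite sqr_sqrtr// sqdist_ge0.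
pose dot := \sum_(i < d) (z ord0 i - x ord0 i) * v ord0 i.
have -> : sqdist (x + s *: v) z = r ^+ 2 - 2 * s * dot + s ^+ 2 * a ^+ 2.
  rewrite r2 a2 /sqdist /dot !mulr_sumr -sumrB -big_split /=.
  by apply: eq_bigr => i _; rewrite !mxE; ring.
suff : dot <= r * a by nra.
(* Cauchy-Schwarz: expand the nonnegative sum of squares of [a (z - x) - r v] and divide by [a r];
   if [a r = 0], one of the two vectors is zero. *)
have [ar|] := ltP 0 (a * r).
  rewrite -(ler_pM2l ar).
  suff : 0 <= a ^+ 2 * r ^+ 2 - 2 * a * r * dot + r ^+ 2 * a ^+ 2 by nra.
  rewrite {1}r2 {2}a2 /sqdist /dot !mulr_sumr -sumrB -big_split /=.
  apply: sumr_ge0 => i _; rewrite !mxE subr0.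
  have := sqr_ge0 (a * (z ord0 i - x ord0 i) - r * v ord0 i); nra.
move=> ar; have /eqP : a * r = 0 by apply/le_anti; rewrite ar mulr_ge0.
rewrite mulf_eq0 => ar0; rewrite /dot big1 ?mulr_ge0// => i _.
case/orP: ar0 => /eqP e0.
  by rewrite (@sqdist_eq0 0 v) ?mxE ?mulr0// -a2 e0 expr0n.
by rewrite (@sqdist_eq0 x z) ?subrr ?mul0r// -r2 e0 expr0n.
Qed.

(** Completing the square in [z]: given its endpoints, the bridge at time [s] is centred on the
    segment from [x] to [y] and spreads like the heat kernel of time [s (t - s) / t]. *)
Lemma sqdist_bridge x y z s t : 0 < s -> s < t ->
  sqdist x z / (4 * s) + sqdist z y / (4 * (t - s)) - sqdist x y / (4 * t) =
  sqdist (x + s *: (t^-1 *: (y - x))) z / (4 * (s * (t - s) / t)).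
Proof.
move=> s0 st; have ts : 0 < t - s by rewrite subr_gt0.
have t0 : 0 < t by exact: lt_trans st.
rewrite /sqdist !mulr_suml -big_split -sumrB /=; apply: eq_bigr => i _.
by rewrite !mxE; field; rewrite !gt_eqF.
Qed.

End sqdist.

Section gauss.
Context {R : realType} {d : nat}.
Hypothesis d2 : (d <= 2)%N.
Implicit Types (x y z v : 'rV[R]_d) (s t : R).

Definition gauss_peak t : R := powR (4 * pi * t) (- (d%:R / 2)).

Lemma gaussE t x y :
  gauss t x y = gauss_peak t * expR (- (sqdist x y / (4 * t))).
Proof. by []. Qed.

Lemma gauss_peak_gt0 t : 0 < t -> 0 < gauss_peak t.
Proof. by move=> t0; rewrite powR_gt0// !mulr_gt0// pi_gt0. Qed.

Lemma gauss_gt0 t x y : 0 < t -> 0 < gauss t x y.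
Proof. by move=> t0; rewrite gaussE mulr_gt0 ?gauss_peak_gt0 ?expR_gt0. Qed.

Lemma gauss_ge0 t x y : 0 <= gauss t x y.
Proof. by rewrite /gauss mulr_ge0 ?powR_ge0 ?expR_ge0. Qed.

Lemma gaussC t x y : gauss t x y = gauss t y x.
Proof. by rewrite /gauss sqdistC. Qed.

Lemma gauss_peak_scale (u t : R) : 0 <= u -> 0 <= t ->
  gauss_peak (u * t) = powR u (- (d%:R / 2)) * gauss_peak t.
Proof.
move=> u0 t0; rewrite /gauss_peak mulrCA (powRM _ u0)//.
by rewrite !mulr_ge0 ?pi_ge0.
Qed.

(** The two peaks differ by the factor [(t / s) ^ (d / 2)], where [t / s >= 1] and the exponent lies
    between 0 and 1 because [d <= 2]. *)
Lemma gauss_peak_le s t : 0 < s -> s <= t ->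
  gauss_peak t <= gauss_peak s <= t / s * gauss_peak t.
Proof.
move=> s0 st; have t0 : 0 < t by exact: lt_le_trans st.
have pt := gauss_peak_gt0 _ t0.
have -> : gauss_peak s = powR (t / s) (d%:R / 2) * gauss_peak t.
  rewrite -{1}(divfK (lt0r_neq0 t0) s) gauss_peak_scale ?divr_ge0 ?ltW//.
  congr (_ * _); rewrite powRN -[LHS]powR_inv1 ?powR_ge0// powRAC.
  by rewrite powR_inv1 ?divr_ge0 ?ltW// invf_div.
have ts1 : 1 <= t / s by rewrite ler_pdivlMr// mul1r.
have ts0 : 0 <= t / s by exact: le_trans ts1.
rewrite ler_pMl// ler_pM2r//; apply/andP; split.
  have := @ler_powR _ _ ts1 0 (d%:R / 2); rewrite powRr0; apply.
  exact: divr_ge0.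
have := @ler_powR _ _ ts1 (d%:R / 2) 1; rewrite powRr1//; apply.
by rewrite ler_pdivrMr// mul1r ler_nat.
Qed.

Lemma bridgeE x y z s t : 0 < s -> s < t ->
  gauss s x z * gauss (t - s) z y / gauss t x y =
  gauss (s * (t - s) / t) (x + s *: (t^-1 *: (y - x))) z.
Proof.
move=> s0 st; have ts : 0 < t - s by rewrite subr_gt0.
have t0 : 0 < t by exact: lt_trans st.
rewrite [RHS]gaussE -sqdist_bridge// !gaussE.
set A := sqdist x z / _; set B := sqdist z y / _; set C := sqdist x y / _.
have -> : expR (- (A + B - C)) = expR (- A) * expR (- B) * (expR (- C))^-1.
  by rewrite -expRN -!expRD; congr expR; ring.
have -> : gauss_peak (s * (t - s) / t) =
    gauss_peak s * gauss_peak (t - s) / gauss_peak t.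
  rewrite /gauss_peak; have := mulr_gt0 (ltr0Sn R 3) (pi_gt0 R).
  move: (4 * pi) => p p0; rewrite -[(_ `^ _)^-1]powR_inv1 ?powR_ge0//.
  rewrite (powRAC (p * t)) powR_inv1 ?mulr_ge0 ?ltW// -powRM ?mulr_ge0 ?ltW//.
  rewrite -powRM ?invr_ge0 ?mulr_ge0 ?ltW ?mulr_gt0//.
  by congr powR; field; rewrite !gt_eqF.
by rewrite invfM; ring.
Qed.

(** For [s <= t / 2] the time [u = s (t - s) / t] lies in [[s / 2, s]]. Replacing [u] by [s] costs
    at most the factor [s / u <= 2] in the peak and can only increase the exponential. *)
Lemma bridge_le x y z s t : 0 < s -> s <= t / 2 ->
  gauss s x z * gauss (t - s) z y / gauss t x y <=
  2 * gauss s (x + s *: (t^-1 *: (y - x))) z.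
Proof.
move=> s0 st2; have st : s < t by lra.
have t0 : 0 < t by exact: lt_trans st.
rewrite bridgeE//; set u := s * (t - s) / t; set x' := x + _.
have u0 : 0 < u by rewrite divr_gt0// mulr_gt0// subr_gt0.
have us : u <= s by rewrite ler_pdivrMr// ler_pM2l//; lra.
have s2u : s / u <= 2.
  by rewrite ler_pdivrMr// /u mulrA ler_pdivlMr// mulrCA ler_pM2l//; lra.
rewrite !gaussE mulrA; apply: ler_pM => //.
- by rewrite ltW ?gauss_peak_gt0.
- have /andP[_ /le_trans] := gauss_peak_le _ _ u0 us; apply.
  by rewrite ler_pM2r ?gauss_peak_gt0.
- rewrite ler_expR lerN2 ler_wpM2l ?sqdist_ge0//.
  have us4 : 0 < 4 * s by rewrite mulr_gt0.
  have u4 : 0 < 4 * u by rewrite mulr_gt0.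
  by rewrite lef_pV2 ?posrE //; lra.
Qed.

(** The boolean cast to [R] is the indicator of the region where the drift matters. Outside it, [|z
    - x - s v|^2 >= r^2 - 2 s r a >= r^2 - 4 s], so dropping the drift costs at most 1 in the
    exponent. *)
Lemma gauss_drift_le x z v s t : 0 < s -> s <= t ->
  gauss s (x + s *: v) z <= expR 1 * gauss s x z +
    (2 < Num.sqrt (sqdist x z) * Num.sqrt (sqdist 0 v))%R%:R *
    (t / s * gauss_peak t * expR (- (sqdist (x + s *: v) z / (4 * s)))).
Proof.
move=> s0 st; have t0 : 0 < t by exact: lt_le_trans st.
have [ra|ra] := ltP 2 _.
  rewrite mul1r -[leLHS]add0r lerD//.
    by rewrite mulr_ge0 ?expR_ge0 ?gauss_ge0.
  rewrite gaussE ler_wpM2r ?expR_ge0//.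
  by have /andP[] := gauss_peak_le _ _ s0 st.
rewrite mul0r addr0 !gaussE mulrCA ler_pM2l ?gauss_peak_gt0// -expRD ler_expR.
have s4 : 0 < 4 * s by rewrite mulr_gt0.
suff : sqdist x z / (4 * s) <= sqdist (x + s *: v) z / (4 * s) + 1 by lra.
rewrite ler_pdivrMr// mulrDl divfK ?gt_eqF// mul1r.
have := sqdist_to_ray_ge x v z s (ltW s0); set r := Num.sqrt (sqdist x z) in ra *.
have r2 : r ^+ 2 = sqdist x z by rewrite sqr_sqrtr// sqdist_ge0.
have := sqr_ge0 (s * Num.sqrt (sqdist 0 v)); rewrite -r2; nra.
Qed.

End gauss.

(** * Time integrals along a ray *)

(* With [w s = a * sqrt s - r / sqrt s] the integrand is the derivative of
   [8 * atan (w s)]; it majorizes the drift kernels since [exp (- w ^ 2 / 8) <= 8 / (1 + w ^ 2)]. *)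
Section drift_integral.
Context {R : realType}.
Notation mu := (@lebesgue_measure R).
Variables (a r : R).
Hypotheses (a0 : 0 <= a) (r0 : 0 <= r).
Implicit Types s : R.

Let w s : R := a * Num.sqrt s - r * (Num.sqrt s)^-1.
Let dw s : R := a * (2 * Num.sqrt s)^-1 + r * ((Num.sqrt s) ^- 2 * (2 * Num.sqrt s)^-1).
Let f s : R := 8 * ((1 + w s ^+ 2)^-1 * dw s).

Let dw_ge0 s : 0 <= dw s.
Proof.
rewrite addr_ge0// mulr_ge0// ?mulr_ge0// invr_ge0 ?exprn_ge0 ?mulr_ge0 ?sqrtr_ge0//.
Qed.

Let f_ge0 s : 0 <= f s.
Proof. by rewrite !mulr_ge0// invr_ge0 addr_ge0 ?sqr_ge0. Qed.

Let is_derive_w s : 0 < s -> is_derive s 1 w (dw s).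
Proof.
move=> s0; have q0 : Num.sqrt s != 0 by rewrite gt_eqF ?sqrtr_gt0.
have dq := is_derive1_sqrt s0.
have dqi := is_deriveV (f := Num.sqrt) q0.
apply: is_derive_eq; rewrite /dw /GRing.scale /=; ring.
Qed.

Let is_derive_atanw s : 0 < s -> is_derive s 1 (8 \*: (atan \o w)) (f s).
Proof.
move=> s0; have dws := is_derive_w s s0.
exact: is_deriveZ (is_derive1_comp (is_derive1_atan _) dws).
Qed.

Let continuous_f s : 0 < s -> {for s, continuous f}.
Proof.
move=> s0; have q0 : Num.sqrt s != 0 by rewrite gt_eqF ?sqrtr_gt0.
have cq : Num.sqrt t @[t --> s] --> Num.sqrt s by exact: sqrt_continuous.
have cqV : (Num.sqrt t)^-1 @[t --> s] --> (Num.sqrt s)^-1 by exact: cvgV.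
have cw : w t @[t --> s] --> w s.
  by apply: cvgB; apply: cvgM => //; exact: cvg_cst.
have c2q : (2 * Num.sqrt t)^-1 @[t --> s] --> (2 * Num.sqrt s)^-1.
  by apply: cvgV; [rewrite mulf_neq0|apply: cvgM => //; exact: cvg_cst].
apply: cvgM; first exact: cvg_cst.
apply: cvgM.
  apply: cvgV; first by rewrite gt_eqF// ltr_pwDl ?sqr_ge0.
  by apply: cvgD; [exact: cvg_cst|apply: cvgM].
apply: cvgD; apply: cvgM; [exact: cvg_cst|exact: c2q|exact: cvg_cst|].
apply: cvgM => //; apply: cvgV; first by rewrite expf_neq0.
exact: cvgM.
Qed.

(** The integral is [8 * (atan (w c) - atan (w b))], and [atan] takes values in an interval of
    length [pi]. *)
Let integral_f_le b c : 0 < b -> b < c ->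
  (\int[mu]_(s in `[b, c]) (f s)%:E <= (8 * pi)%:E)%E.
Proof.
move=> b0 bc; have gt0 s : b <= s -> 0 < s by exact: lt_le_trans.
have dF s : b <= s -> is_derive s 1 (8 \*: (atan \o w)) (f s).
  by move=> /gt0; exact: is_derive_atanw.
have cF s : b <= s -> {for s, continuous (8 \*: (atan \o w))}.
  by move=> /dF [/derivable1_diffP /differentiable_continuous].
rewrite (continuous_FTC2 (F := 8 \*: (atan \o w)) bc).
- rewrite -EFinB lee_fin /= /GRing.scale /= -mulrBr ler_pM2l//.
  have := atan_ltpi2 (w c); have := atan_gtNpi2 (w b); lra.
- apply: continuous_in_subspaceT => s; rewrite inE /= in_itv /= => /andP[bs _].
  by apply: continuous_f; exact: gt0.
- split.
  + by move=> s; rewrite in_itv /= => /andP[/ltW/dF[]].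
  + by apply: cvg_at_right_filter; exact: cF.
  + by apply: cvg_at_left_filter; apply: cF; exact: ltW.
- move=> s; rewrite in_itv /= => /andP[/ltW/dF dFs _].
  by rewrite derive1E; exact: derive_val.
Qed.

(** The bound on compact intervals does not depend on them, so it passes to the half-line by
    monotone convergence. It is also uniform in [a] and [r]. *)
Lemma integral_drift_le :
  (\int[mu]_(s in `]0%R, +oo[) (8 * ((1 + (a * Num.sqrt s - r / Num.sqrt s) ^+ 2)^-1 *
     (a / (2 * Num.sqrt s) + r / (2 * s * Num.sqrt s))))%:E <= (8 * pi)%:E)%E.
Proof.
have -> : (\int[mu]_(s in `]0%R, +oo[) (8 * ((1 + (a * Num.sqrt s - r / Num.sqrt s) ^+ 2)^-1 *
     (a / (2 * Num.sqrt s) + r / (2 * s * Num.sqrt s))))%:E = \int[mu]_(s in `]0%R, +oo[) (f s)%:E)%E.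
  apply: eq_integral => s; rewrite inE /= in_itv /= andbT => s0.
  congr (8 * (_ * (_ + r * _)))%:E.
  rewrite -{1}(sqr_sqrtr (ltW s0)) -!invfM; congr (_^-1).
  by rewrite expr2; ring.
have -> : `]0%R, +oo[%classic = \bigcup_n `[n.+1%:R^-1, n.+1%:R]%classic :> set R.
  apply/seteqP; split => s /=; last first.
    move=> [n _] /=; rewrite !in_itv /= andbT => /andP[ns _].
    by apply: lt_le_trans ns; rewrite invr_gt0.
  rewrite in_itv /= andbT => s0; pose n := Num.truncn (Num.max s s^-1).
  have := truncnS_gt (Num.max s s^-1); rewrite -/n gt_max => /andP[sn snV].
  exists n => //=; rewrite in_itv /= (ltW sn) andbT.
  by rewrite -[leRHS]invrK lef_pV2 ?posrE ?invr_gt0// ltW.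
have mf n : measurable_fun (`[n.+1%:R^-1, n.+1%:R]%classic : set R) (EFin \o f).
  apply/measurable_EFinP; apply: subspace_continuous_measurable_fun => //.
  apply: continuous_in_subspaceT => s; rewrite inE /= in_itv /= => /andP[bs _].
  by apply: continuous_f; apply: lt_le_trans bs; rewrite invr_gt0.
have nd : nondecreasing_seq (fun n => `[n.+1%:R^-1, n.+1%:R]%classic : set R).
  move=> m n mn; rewrite subsetEset => s /=; rewrite !in_itv /= => /andP[ms sm].
  apply/andP; split.
    by apply: le_trans ms; rewrite lef_pV2 ?posrE// ler_nat.
  by apply: (le_trans sm); rewrite ler_nat.
have cvg_int := @ge0_nondecreasing_set_cvg_integral _ _ _ _ _ mu nd
  (fun=> measurable_itv _) mf (fun n s _ => f_ge0 s).
rewrite -(cvg_lim _ cvg_int)//.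
apply: lime_le; first by apply/cvg_ex; eexists; exact: cvg_int.
near=> n; apply: integral_f_le; first by rewrite invr_gt0.
(* For [n = 0] the interval is the single point 1; the strict inequality of endpoints starts at
   [n = 1]. *)
have n1 : (0 < n)%N by near: n; exists 1%N.
by rewrite (@lt_trans _ _ 1)// ?invf_lt1// ltr1n ltnS.
Unshelve. all: by end_near. Qed.

End drift_integral.

(** * Measurability of the kernels *)

Section measurability.
Context {R : realType} {dT : measure_display} {T : measurableType dT}.

(* [x^-1 = x * (x ^+ 2) `^ (-1)] also holds at [x = 0], where both sides are [0]. *)
Lemma measurable_funV (f : T -> R) :
  measurable_fun setT f -> measurable_fun setT (fun x => (f x)^-1).
Proof.
move=> mf; have -> : (fun x => (f x)^-1) = (fun x => f x * (f x ^+ 2) `^ (-1)).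
  apply/funext => x; rewrite powR_inv1 ?sqr_ge0//.
  have [->|fx0] := eqVneq (f x) 0; first by rewrite invr0 mul0r.
  by rewrite expr2 invfM mulrA divff// mul1r.
apply: measurable_funM => //.
exact: (measurableT_comp (measurable_powR (-1)) (measurable_funX 2 mf)).
Qed.

Lemma measurable_fun_sqrt (f : T -> R) :
  measurable_fun setT f -> measurable_fun setT (fun x => Num.sqrt (f x)).
Proof.
move=> mf; apply: (measurableT_comp (f := @Num.sqrt R)) => //.
by apply: continuous_measurable_fun; exact: sqrt_continuous.
Qed.

Lemma measurable_sqdist {d : nat} (X Y : T -> 'rV[R]_d) :
  (forall i, measurable_fun setT (fun p => X p ord0 i)) ->
  (forall i, measurable_fun setT (fun p => Y p ord0 i)) ->
  measurable_fun setT (fun p => sqdist (X p) (Y p)).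
Proof.
move=> mX mY; apply: measurable_sum => i; apply: measurable_funX.
exact: measurable_funB.
Qed.

Lemma measurable_expN_div (f g : T -> R) :
  measurable_fun setT f -> measurable_fun setT g ->
  measurable_fun setT (fun p => expR (- (f p / g p))).
Proof.
move=> mf mg; apply: measurableT_comp => //; apply: measurableT_comp => //.
by apply: measurable_funM => //; exact: measurable_funV.
Qed.

Lemma measurable_gauss {d : nat} (t : T -> R) (X Y : T -> 'rV[R]_d) :
  measurable_fun setT t ->
  (forall i, measurable_fun setT (fun p => X p ord0 i)) ->
  (forall i, measurable_fun setT (fun p => Y p ord0 i)) ->
  measurable_fun setT (fun p => gauss (t p) (X p) (Y p)).
Proof.
move=> mt mX mY; apply: measurable_funM.
  have m4t : measurable_fun setT (fun p => 4 * pi * t p) by exact: measurable_funM.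
  exact: (measurableT_comp (measurable_powR _) m4t).
apply: measurable_expN_div; first exact: measurable_sqdist.
exact: measurable_funM.
Qed.

Lemma le_integral_fun (mu : {measure set T -> \bar R}) (D : set T) (f g : T -> R) :
  measurable D -> measurable_fun setT f -> measurable_fun setT g ->
  (forall x, D x -> 0 <= f x <= g x) ->
  (\int[mu]_(x in D) (f x)%:E <= \int[mu]_(x in D) (g x)%:E)%E.
Proof.
move=> mD mf mg fg; apply: ge0_le_integral => //.
- by move=> x /fg/andP[f0 _]; rewrite lee_fin.
- by apply/measurable_EFinP; exact: measurable_funTS.
- by apply/measurable_EFinP; exact: measurable_funTS.
- by move=> x /fg/andP[_ fgx]; rewrite lee_fin.
Qed.

End measurability.

(** * Exponential time integrals near and far from time zero *)

Section drift_bounds.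
Context {R : realType}.
Notation leb := (@lebesgue_measure R).
Variables (a r : R).
Hypotheses (a0 : 0 <= a) (r0 : 0 <= r).
Implicit Types s : R.

Let w s : R := a * Num.sqrt s - r / Num.sqrt s.
Let dw s : R := a / (2 * Num.sqrt s) + r / (2 * s * Num.sqrt s).

(** The exponent equals [w s ^+ 2 / 8], and [exp (w^2 / 8) >= 1 + w^2 / 8 >= (1 + w^2) / 8]. *)
Let expR_drift_le s : 0 < s ->
  expR (- ((r - s * a) ^+ 2 / (8 * s))) <= 8 / (1 + w s ^+ 2).
Proof.
move=> s0; have q0 : 0 < Num.sqrt s by rewrite sqrtr_gt0.
have w0 : 0 < 1 + w s ^+ 2 by rewrite ltr_pwDl ?sqr_ge0.
have -> : (r - s * a) ^+ 2 / (8 * s) = w s ^+ 2 / 8.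
  rewrite /w -{1 2}(sqr_sqrtr (ltW s0)); by field; rewrite gt_eqF.
rewrite expRN -[leRHS]invrK lef_pV2 ?posrE ?expR_gt0 ?invr_gt0 ?divr_gt0//.
rewrite invf_div; apply: le_trans (expR_ge1Dx _).
by rewrite mulrDl lerD2r; lra.
Qed.

Let measurable_drift_majorant :
  measurable_fun setT (fun s => 8 * ((1 + w s ^+ 2)^-1 * dw s)).
Proof.
have mq : measurable_fun setT (@Num.sqrt R) by exact: measurable_fun_sqrt.
have mqV : measurable_fun setT (fun s => (Num.sqrt s)^-1 : R) by exact: measurable_funV.
apply: measurable_funM => //; apply: measurable_funM.
  apply: measurable_funV; apply: measurable_funD => //; apply: measurable_funX.
  by apply: measurable_funB; exact: measurable_funM.
by apply: measurable_funD; apply: measurable_funM => //;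
   apply: measurable_funV; do ?apply: measurable_funM.
Qed.

Lemma measurable_drift :
  measurable_fun setT (fun s => s^-1 * expR (- ((r - s * a) ^+ 2 / (8 * s)))).
Proof.
apply: measurable_funM; first exact: measurable_funV.
apply: measurable_expN_div; last exact: measurable_funM.
by apply: measurable_funX; apply: measurable_funB => //; exact: measurable_funM.
Qed.

(** Once the weight [s^-1] is traded for [k * dw s], the integrand lies below [k] times the explicit
    majorant of integral at most [8 * pi]. The next two lemmas choose [k]. *)
Lemma integral_drift_scaled_le (D : set R) (k : R) :
  measurable D -> D `<=` `]0, +oo[%classic -> 0 <= k ->
  (forall s, D s -> s^-1 <= k * dw s) ->
  (\int[leb]_(s in D) (s^-1 * expR (- ((r - s * a) ^+ 2 / (8 * s))))%:E
    <= (k * (8 * pi))%:E)%E.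
Proof.
move=> mD D0 k0 Dk; have sgt0 s : D s -> 0 < s.
  by move=> /D0 /=; rewrite in_itv /= andbT.
apply: (@le_trans _ _ (\int[leb]_(s in D) (k * (8 * ((1 + w s ^+ 2)^-1 * dw s)))%:E)%E).
  apply: le_integral_fun => //.
  - exact: measurable_drift.
  - exact: measurable_funM.
  move=> s Ds; have s0 := sgt0 _ Ds; rewrite mulr_ge0 ?invr_ge0 ?(ltW s0) ?expR_ge0//=.
  have -> : k * (8 * ((1 + w s ^+ 2)^-1 * dw s)) = k * dw s * (8 / (1 + w s ^+ 2)).
    by ring.
  by apply: ler_pM; rewrite ?invr_ge0 ?(ltW s0) ?expR_ge0 ?Dk ?expR_drift_le.
under eq_integral do rewrite EFinM.
have f0 s : 0 < s -> (0 <= (8 * ((1 + w s ^+ 2)^-1 * dw s))%:E)%E.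
  move=> s0; rewrite lee_fin mulr_ge0// mulr_ge0 ?invr_ge0 ?addr_ge0 ?sqr_ge0//.
    by rewrite divr_ge0// mulr_ge0// sqrtr_ge0.
  by rewrite divr_ge0// mulr_ge0 ?sqrtr_ge0// mulr_ge0// ltW.
have mf : measurable_fun setT (fun s => (8 * ((1 + w s ^+ 2)^-1 * dw s))%:E).
  exact/measurable_EFinP.
rewrite ge0_integralZl_EFin//; last 2 first.
- by move=> s /sgt0/f0.
- exact: measurable_funTS.
rewrite EFinM lee_wpmul2l ?lee_fin//.
apply: le_trans (integral_drift_le a r a0 r0).
apply: ge0_subset_integral => //; first exact: measurable_funTS.
by move=> s /=; rewrite in_itv /= andbT => /f0.
Qed.

(** Here [k = 1]: the condition amounts to [2 sqrt s <= a s + r], which follows from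
    [(a s + r)^2 >= 4 a r s] and [r a >= 2]. *)
Lemma integral_drift_near_le (D : set R) :
  measurable D -> D `<=` `]0, +oo[%classic -> 2 <= r * a ->
  (\int[leb]_(s in D) (s^-1 * expR (- ((r - s * a) ^+ 2 / (8 * s))))%:E
    <= (8 * pi)%:E)%E.
Proof.
move=> mD D0 ra; rewrite -[8 * pi]mul1r.
apply: integral_drift_scaled_le => // s /D0 /=; rewrite in_itv /= andbT => s0.
rewrite mul1r; have q0 : 0 < Num.sqrt s by rewrite sqrtr_gt0.
move: q0 (sqr_sqrtr (ltW s0)); rewrite /dw; move: (Num.sqrt s) => q q0 qs.
have -> : a / (2 * q) + r / (2 * s * q) = s^-1 * ((a * s + r) / (2 * q)).
  by field; rewrite !gt_eqF.
rewrite ler_pMr ?invr_gt0// ler_pdivlMr ?mulr_gt0// mul1r.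
have ars : 0 <= (r * a - 2) * s by rewrite mulr_ge0 ?subr_ge0// ltW.
have := sqr_ge0 (a * s - r) => sq.
rewrite -(@ler_pXn2r _ 2) ?nnegrE ?addr_ge0 ?mulr_ge0 ?(ltW q0) ?(ltW s0)//.
nra.
Qed.

(** Here [k = 2 / (a sqrt s1)]: the first term of [dw s] alone suffices, since
    [s^-1 <= 1 / (sqrt s1 * sqrt s)] for [s >= s1]. *)
Lemma integral_drift_far_le (D : set R) (s1 : R) :
  measurable D -> 0 < s1 -> D `<=` `[s1, +oo[%classic -> 0 < a ->
  (\int[leb]_(s in D) (s^-1 * expR (- ((r - s * a) ^+ 2 / (8 * s))))%:E
    <= (16 * pi / (a * Num.sqrt s1))%:E)%E.
Proof.
move=> mD s10 Ds1 agt0; have q1 : 0 < Num.sqrt s1 by rewrite sqrtr_gt0.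
have -> : 16 * pi / (a * Num.sqrt s1) = 2 / (a * Num.sqrt s1) * (8 * pi) by ring.
apply: integral_drift_scaled_le => //.
- move=> s /Ds1 /=; rewrite !in_itv /= !andbT; exact: lt_le_trans.
- by rewrite divr_ge0// mulr_ge0// ltW.
move=> s /Ds1 /=; rewrite in_itv /= andbT => s1s.
have s0 : 0 < s by exact: lt_le_trans s1s.
have qq : Num.sqrt s1 <= Num.sqrt s by rewrite ler_wsqrtr.
have q0 : 0 < Num.sqrt s by rewrite sqrtr_gt0.
rewrite /dw; apply: (@le_trans _ _ (2 / (a * Num.sqrt s1) * (a / (2 * Num.sqrt s)))).
  have -> : 2 / (a * Num.sqrt s1) * (a / (2 * Num.sqrt s)) = (Num.sqrt s1 * Num.sqrt s)^-1.
    by field; rewrite !gt_eqF.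
  rewrite lef_pV2 ?posrE ?mulr_gt0// -[leRHS](sqr_sqrtr (ltW s0)) expr2.
  by rewrite ler_pM2r.
rewrite ler_pM2l ?divr_gt0 ?mulr_gt0// lerDl divr_ge0//.
by rewrite !mulr_ge0// ltW.
Qed.

End drift_bounds.

(** * Tonelli and reflection *)

Section lebesgue_tools.
Context {R : realType} {dZ : measure_display} {Z : measurableType dZ}.
Variable mu : {sigma_finite_measure set Z -> \bar R}.
Notation leb := (@lebesgue_measure R).

Lemma integral_mul_indic (D : set R) (f : R -> \bar R) :
  (\int[leb]_(s in D) f s = \int[leb]_s (f s * (\1_D s)%:E))%E.
Proof.
rewrite integral_mkcond; apply: eq_integral => s _.
by rewrite patchE indicE; case: ifPn => _; rewrite ?mule1 ?mule0.
Qed.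

Section iterated.
Variables (D : set R) (F : R * Z -> R).
Hypotheses (mD : measurable D) (mF : measurable_fun setT F).
Hypothesis F0 : forall s z, D s -> 0 <= F (s, z).

(** The cut-off makes the integrand nonnegative everywhere, as Tonelli requires, while [F] is only
    known to be nonnegative for times in [D]. *)
Let G (p : R * Z) : \bar R := (\1_D p.1 * F p)%:E.

Let mG : measurable_fun setT G.
Proof.
apply/measurable_EFinP; apply: measurable_funM => //.
exact: (measurableT_comp (measurable_indic _) measurable_fst).
Qed.

Let G0 p : (0 <= G p)%E.
Proof.
case: p => s z; rewrite lee_fin /= indicE; case: (boolP (s \in D)) => [|_].
  by rewrite inE => Ds; rewrite mul1r F0.
by rewrite mul0r.
Qed.

Let integral_G s :
  (\int[mu]_z G (s, z) = \int[mu]_z (F (s, z))%:E * (\1_D s)%:E)%E.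
Proof.
rewrite /G /= indicE; case: (s \in D).
  by rewrite mule1; under eq_integral do rewrite mul1r.
by rewrite mule0 integral0_eq// => z _; rewrite mul0r.
Qed.

Lemma measurable_integral_snd :
  measurable_fun D (fun s => \int[mu]_z (F (s, z))%:E)%E.
Proof.
have := @measurable_fun_fubini_tonelli_F _ _ _ _ _ mu G mG G0.
move=> /(measurable_funTS (D := D)); apply: eq_measurable_fun => s sD.
by rewrite /fubini_F integral_G indicE sD mule1.
Qed.

Lemma tonelli_in :
  (\int[leb]_(s in D) \int[mu]_z (F (s, z))%:E =
   \int[mu]_z \int[leb]_(s in D) (F (s, z))%:E)%E.
Proof.
rewrite integral_mul_indic; under eq_integral do rewrite -integral_G.
rewrite fubini_tonelli//; apply: eq_integral => z _.
by rewrite integral_mul_indic; apply: eq_integral => s _; rewrite muleC.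
Qed.

Lemma measurable_integral_fst :
  measurable_fun setT (fun z => \int[leb]_(s in D) (F (s, z))%:E)%E.
Proof.
have := @measurable_fun_fubini_tonelli_G _ _ _ _ _ leb G mG G0.
congr measurable_fun; apply/funext => z; rewrite /fubini_G integral_mul_indic.
by apply: eq_integral => s _; rewrite muleC.
Qed.

End iterated.

Lemma le_integral_integral (D : set R) (F G : R * Z -> R) :
  measurable D -> measurable_fun setT F -> measurable_fun setT G ->
  (forall s z, D s -> 0 <= F (s, z) <= G (s, z)) ->
  (\int[leb]_(s in D) \int[mu]_z (F (s, z))%:E <=
   \int[leb]_(s in D) \int[mu]_z (G (s, z))%:E)%E.
Proof.
move=> mD mF mG FG; apply: ge0_le_integral => //.
- move=> s Ds; apply: integral_ge0 => z _; rewrite lee_fin.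
  by have /andP[] := FG s z Ds.
- by apply: measurable_integral_snd => // s z /(FG _ z)/andP[].
- by apply: measurable_integral_snd => // s z /(FG _ z)/andP[]; exact: le_trans.
- move=> s Ds; apply: le_integral_fun => //.
  + exact: (measurableT_comp mF (measurable_pair1 s)).
  + exact: (measurableT_comp mG (measurable_pair1 s)).
  + by move=> z _; exact: FG.
Qed.

(** By uniqueness of Lebesgue measure it suffices to test intervals: []a, b]] pulls back to [[t - b,
    t - a[], of the same length. *)
Lemma lebesgue_measure_reflection (t : R) (A : set R) : measurable A ->
  pushforward leb ((fun s => t - s) : _ -> measurableTypeR R) A = leb A.
Proof.
move=> mA; apply/esym/lebesgue_measure_unique => //=; first exact: measurable_funB.
move=> _ _ [[a b]] _ <-.
rewrite /pushforward.
have -> : (fun s : R => t - s) @^-1` `]a, b]%classic = `[t - b, t - a[%classic.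
  by apply/seteqP; split => s /=; rewrite !in_itv /= => /andP[? ?]; apply/andP; split; lra.
rewrite /= !lebesgue_measure_itv /= !lte_fin ltrD2l ltrN2.
by case: ifPn => // _; rewrite -!EFinB; congr (_%:E); ring.
Qed.

Lemma integral_reflection (t : R) (D : set R) (f : R -> \bar R) :
  measurable D -> measurable_fun setT f -> (forall s, 0 <= f s)%E ->
  (\int[leb]_(s in D) f s = \int[leb]_(s in [set s | D (t - s)%R]) f (t - s)%R)%E.
Proof.
move=> mD mf f0; pose rho (s : R) : measurableTypeR R := t - s.
have mrho : measurable_fun setT rho by exact: measurable_funB.
transitivity (\int[pushforward leb rho]_(s in D) f s)%E; last first.
  by rewrite ge0_integral_pushforward//; exact: measurable_funTS.
apply: eq_measure_integral => //= A mA _.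
exact/esym/lebesgue_measure_reflection.
Qed.

End lebesgue_tools.

(** * Consequences of a Kato bound *)

Section kato.
Context {R : realType} {d : nat} {dZ : measure_display} {Z : measurableType dZ}.
Variables (mu : {sigma_finite_measure set Z -> \bar R}).
Variables (phi : Z -> 'rV[R]_d) (W : Z -> R).
Hypotheses (d2 : (d <= 2)%N).
Hypothesis mphi : forall i, measurable_fun setT (fun z => phi z ord0 i).
Hypotheses (mW : measurable_fun setT W) (W0 : forall z, 0 <= W z).
Hypothesis gauss1 : forall t x, 0 < t -> (\int[mu]_z (gauss t x (phi z))%:E = 1)%E.
Notation leb := (@lebesgue_measure R).
Notation pk := (@gauss_peak R d).
Implicit Types (x y v : 'rV[R]_d) (s t : R).

Lemma measurable_gauss_phi t x : measurable_fun setT (fun z => gauss t x (phi z)).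
Proof.
exact: measurable_gauss.
Qed.

Lemma measurable_sqdist_phi x : measurable_fun setT (fun z => sqdist x (phi z)).
Proof.
exact: measurable_sqdist.
Qed.

(** Space enters through a model: a sigma-finite [Z] with measurable coordinates [phi], in which
    every heat kernel has mass one. [W] stands for the absolute value of the potential. *)
Definition kato_bound (t m : R) : Prop := forall x,
  (\int[leb]_(s in `]0%R, t[) \int[mu]_z (gauss s x (phi z) * W z)%:E <= m%:E)%E.

Section fixed_time.
Variables (t m : R).
Hypotheses (t0 : 0 < t) (m0 : 0 <= m).
Hypothesis kato_le : kato_bound t m.

Lemma measurable_kato_integrand x :
  measurable_fun setT (fun p : R * Z => gauss p.1 x (phi p.2) * W p.2).
Proof.
apply: measurable_funM; last exact: (measurableT_comp mW measurable_snd).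
apply: measurable_gauss; [exact: measurable_fst|by move=> i|move=> i].
exact: (measurableT_comp (mphi i) measurable_snd).
Qed.

(** For every [s] in [[t / 2, t[] the kernel [gauss s x] dominates this window; integrating over a
    time interval of length [t / 2] gives the factor [2 / t]. *)
Lemma kato_gauss_narrow x :
  (\int[mu]_z (pk t * expR (- (sqdist x (phi z) / (2 * t))) * W z)%:E
    <= (2 / t * m)%:E)%E.
Proof.
pose f z := pk t * expR (- (sqdist x (phi z) / (2 * t))) * W z.
have f0 z : 0 <= f z.
  by rewrite /f !mulr_ge0 ?expR_ge0// ltW// gauss_peak_gt0.
have mf : measurable_fun setT f.
  apply: measurable_funM => //; apply: measurable_funM => //.
  by apply: measurable_expN_div => //; exact: measurable_sqdist_phi.
suff : (\int[mu]_z (f z)%:E * (t / 2)%:E <= m%:E)%E.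
  rewrite -lee_pdivlMr ?divr_gt0// => /le_trans; apply.
  by rewrite lee_fin invf_div mulrC.
apply: le_trans (kato_le x).
have -> : (\int[mu]_z (f z)%:E * (t / 2)%:E =
    \int[leb]_(s in `[(t / 2)%R, t[) \int[mu]_z (f z)%:E)%E.
  rewrite integral_cst//; congr (_ * _)%E.
  rewrite /= lebesgue_measure_itv/= lte_fin.
  have -> : t / 2 < t by have := t0; lra.
  by rewrite -EFinB; congr _%:E; field.
apply: (@le_trans _ _ (\int[leb]_(s in `[(t / 2)%R, t[) \int[mu]_z (gauss s x (phi z) * W z)%:E)%E).
  apply: (le_integral_integral mu _ (fun p => f p.2) (fun p => gauss p.1 x (phi p.2) * W p.2)) => //.
  - exact: (measurableT_comp mf measurable_snd).
  - exact: measurable_kato_integrand.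
  - move=> s z /=; rewrite in_itv /= => /andP[ts st].
    have s0 : 0 < s by have := t0; lra.
    rewrite f0 andTb /f /= ler_wpM2r// gaussE ler_pM ?expR_ge0 ?(ltW (gauss_peak_gt0 _ _))//.
      by have /andP[] := gauss_peak_le d2 _ _ s0 (ltW st).
    rewrite ler_expR lerN2 ler_wpM2l ?sqdist_ge0// lef_pV2 ?posrE ?mulr_gt0//; lra.
apply: ge0_subset_integral => //.
- apply: (measurable_integral_snd mu _ (fun p => gauss p.1 x (phi p.2) * W p.2)) => //.
    exact: measurable_kato_integrand.
  by move=> s z _; rewrite mulr_ge0// gauss_ge0.
- by move=> s _; apply: integral_ge0 => z _; rewrite lee_fin mulr_ge0// gauss_ge0.
- move=> s /=; rewrite !in_itv /= => /andP[ts ->]; rewrite andbT; have := t0; lra.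
Qed.

(** A wide Gaussian is dominated by a superposition of narrow windows with centres [phi w], weighted
    by a Gaussian of total mass 32. This lets the narrow estimate control wide windows. *)
Lemma gauss_widen x z :
  ((expR (- (sqdist x (phi z) / (16 * t))))%:E <=
   \int[mu]_w (32 * gauss (8 * t) x (phi w) *
               expR (- (sqdist (phi w) (phi z) / (2 * t))))%:E)%E.
Proof.
have t4 : 0 < t / 4 by rewrite divr_gt0.
set e := expR _.
(* Insert a kernel of mass one around [phi z]; the two integrands are then compared pointwise in
   [w]. *)
have -> : (e%:E = \int[mu]_w (e * gauss (t / 4) (phi z) (phi w))%:E)%E.
  under eq_integral do rewrite EFinM.
  rewrite ge0_integralZl_EFin ?expR_ge0 ?gauss1 ?mule1//.
  - by move=> w _; rewrite lee_fin gauss_ge0.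
  - by apply/measurable_EFinP; exact: measurable_gauss_phi.
apply: le_integral_fun => //.
- by apply: measurable_funM => //; exact: measurable_gauss_phi.
- apply: measurable_funM.
    by apply: measurable_funM => //; exact: measurable_gauss_phi.
  by apply: measurable_expN_div => //; exact: measurable_sqdist.
move=> w _; rewrite mulr_ge0 ?expR_ge0 ?gauss_ge0//= !gaussE.
set A := sqdist x (phi z) in e *; set B := sqdist (phi z) (phi w).
rewrite [sqdist (phi w) _]sqdistC -/B.
have -> : e * (pk (t / 4) * expR (- (B / (4 * (t / 4))))) =
    pk (t / 4) * (e * expR (- (B / (4 * (t / 4))))) by ring.
rewrite [32 * _]mulrA -[leRHS]mulrA; apply: ler_pM.
- by rewrite ltW// gauss_peak_gt0.
- by rewrite mulr_ge0 ?expR_ge0.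
(* The constant 32 is the quotient of the times [8 * t] and [t / 4]. *)
- have t48 : t / 4 <= 8 * t by have := t0; lra.
  have /andP[_ /le_trans] := gauss_peak_le d2 _ _ t4 t48; apply.
  by rewrite le_eqVlt; apply/orP; left; apply/eqP; congr (_ * _); field; rewrite gt_eqF.
rewrite /e -!expRD ler_expR.
(* From [C <= 2 A + 2 B] one gets [C / 32 + B / 2 <= A / 16 + 9 B / 16], hence at most
   [A / 16 + B]. *)
have := sqdist_quasi_triangle (phi z) x (phi w); rewrite -/A -/B => tri.
have B0 : 0 <= B by exact: sqdist_ge0.
set C := sqdist x (phi w) in tri *.
have tV : 0 < t^-1 by rewrite invr_gt0.
have -> : A / (16 * t) = t^-1 * (A / 16) by field; rewrite gt_eqF.
have -> : B / (4 * (t / 4)) = t^-1 * B by field; rewrite gt_eqF.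
have -> : C / (4 * (8 * t)) = t^-1 * (C / 32) by field; rewrite gt_eqF.
have -> : B / (2 * t) = t^-1 * (B / 2) by field; rewrite gt_eqF.
rewrite -!mulrN -!mulrDr ler_pM2l//; lra.
Qed.

(** Write the window as a mixture of narrow ones and apply Tonelli: each centre contributes at most
    [2 / t * m], and the weights have total mass 32. *)
Lemma kato_gauss_wide x :
  (\int[mu]_z (pk t * expR (- (sqdist x (phi z) / (16 * t))) * W z)%:E
    <= (64 / t * m)%:E)%E.
Proof.
have pk0 : 0 <= pk t by rewrite ltW// gauss_peak_gt0.
pose g w := 32 * gauss (8 * t) x (phi w).
pose h w z := pk t * expR (- (sqdist (phi w) (phi z) / (2 * t))) * W z.
have g0 w : 0 <= g w by rewrite mulr_ge0// gauss_ge0.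
have h0 w z : 0 <= h w z by rewrite !mulr_ge0 ?expR_ge0.
have mg : measurable_fun setT g.
  by apply: measurable_funM => //; exact: measurable_gauss_phi.
have mh : measurable_fun setT (fun p : Z * Z => h p.1 p.2).
  apply: measurable_funM; last exact: (measurableT_comp mW measurable_snd).
  apply: measurable_funM => //; apply: measurable_expN_div => //.
  apply: measurable_sqdist => i.
    exact: (measurableT_comp (mphi i) measurable_fst).
  exact: (measurableT_comp (mphi i) measurable_snd).
have mgh : measurable_fun setT (fun p : Z * Z => (g p.1 * h p.1 p.2)%:E).
  by apply/measurable_EFinP; apply: measurable_funM => //; exact: (measurableT_comp mg measurable_fst).
have gh0 p : (0 <= (g p.1 * h p.1 p.2)%:E)%E by rewrite lee_fin mulr_ge0.
apply: (@le_trans _ _ (\int[mu]_z \int[mu]_w (g w * h w z)%:E)%E).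
  apply: ge0_le_integral => //.
  - by move=> z _; rewrite lee_fin !mulr_ge0 ?expR_ge0.
  - apply/measurable_EFinP; apply: measurable_funM => //; apply: measurable_funM => //.
    by apply: measurable_expN_div => //; exact: measurable_sqdist_phi.
  - exact: (measurable_fun_fubini_tonelli_G (fun p => (g p.1 * h p.1 p.2)%:E)).
  move=> z _; rewrite mulrAC EFinM.
  apply: (le_trans (lee_wpmul2l _ (gauss_widen x z))).
    by rewrite lee_fin mulr_ge0.
  have me : measurable_fun setT
      (fun w => g w * expR (- (sqdist (phi w) (phi z) / (2 * t)))).
    by apply: measurable_funM => //; apply: measurable_expN_div => //; exact: measurable_sqdist.
  rewrite -ge0_integralZl_EFin//.
  - under eq_integral do rewrite -EFinM.
    apply: le_integral_fun => //.
    + exact: measurable_funM.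
    + apply: measurable_funM => //.
      exact: (measurableT_comp mh (measurable_pair2 z)).
    + move=> w _; apply/andP; split.
        by apply: mulr_ge0; [rewrite mulr_ge0|apply: mulr_ge0; [exact: g0|exact: expR_ge0]].
      by rewrite le_eqVlt; apply/orP; left; apply/eqP; rewrite /g /h; ring.
  - by move=> w _; rewrite lee_fin; apply: mulr_ge0; [exact: g0|exact: expR_ge0].
  - exact/measurable_EFinP.
  - by rewrite mulr_ge0.
rewrite -(fubini_tonelli (fun p => (g p.1 * h p.1 p.2)%:E))//=.
apply: (@le_trans _ _ (\int[mu]_w (64 / t * m * gauss (8 * t) x (phi w))%:E)%E).
  apply: ge0_le_integral => //.
  - by move=> w _; apply: integral_ge0 => z _; exact: (gh0 (w, z)).
  - exact: (measurable_fun_fubini_tonelli_F (fun p => (g p.1 * h p.1 p.2)%:E)).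
  - by apply/measurable_EFinP; apply: measurable_funM => //; exact: measurable_gauss_phi.
  move=> w _; under eq_integral do rewrite EFinM.
  rewrite ge0_integralZl_EFin//.
  - apply: (le_trans (lee_wpmul2l _ (kato_gauss_narrow (phi w)))); first by rewrite lee_fin.
    by rewrite -EFinM lee_fin le_eqVlt; apply/orP; left; apply/eqP; rewrite /g; ring.
  - by move=> z _; rewrite lee_fin.
  - by apply/measurable_EFinP; exact: (measurableT_comp mh (measurable_pair1 w)).
under eq_integral do rewrite EFinM.
rewrite ge0_integralZl_EFin ?gauss1 ?mule1 ?mulr_gt0//.
- by move=> w _; rewrite lee_fin gauss_ge0.
- by apply/measurable_EFinP; exact: measurable_gauss_phi.
- by rewrite mulr_ge0// divr_ge0// ltW.
Qed.

End fixed_time.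
End kato.

(** With [p^2 - q^2 = 1] and [0 <= q <= p], [p - q = 1 / (p + q) >= 1 / (2 p)]. It sums the bounds
    of the successive time pieces. *)
Lemma invsqrt_le_telescope {R : realType} (n : nat) :
  (Num.sqrt n.+1%:R)^-1 <= 2 * (Num.sqrt n.+1%:R - Num.sqrt n%:R) :> R.
Proof.
have p0 : 0 < Num.sqrt n.+1%:R :> R by rewrite sqrtr_gt0.
have q0 : 0 <= Num.sqrt n%:R :> R by rewrite sqrtr_ge0.
have pq : Num.sqrt n%:R <= Num.sqrt n.+1%:R :> R by rewrite ler_wsqrtr// ler_nat.
have : Num.sqrt n.+1%:R ^+ 2 = Num.sqrt n%:R ^+ 2 + 1 :> R.
  by rewrite !sqr_sqrtr// -natr1.
move: (Num.sqrt _) (Num.sqrt _) p0 q0 pq => p q p0 q0 pq pq2.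
by rewrite -div1r ler_pdivrMr//; nra.
Qed.

(** * Kernels along a ray, over the first half of the time interval *)

Section half_bridge.
Context {R : realType} {d : nat} {dZ : measure_display} {Z : measurableType dZ}.
Variables (mu : {sigma_finite_measure set Z -> \bar R}).
Variables (phi : Z -> 'rV[R]_d) (W : Z -> R).
Hypotheses (d2 : (d <= 2)%N).
Hypothesis mphi : forall i, measurable_fun setT (fun z => phi z ord0 i).
Hypotheses (mW : measurable_fun setT W) (W0 : forall z, 0 <= W z).
Hypothesis gauss1 : forall t x, 0 < t -> (\int[mu]_z (gauss t x (phi z))%:E = 1)%E.
Notation leb := (@lebesgue_measure R).
Notation pk := (@gauss_peak R d).
Variables (t m : R).
Hypotheses (t0 : 0 < t) (m0 : 0 <= m) (kato_le : kato_bound mu phi W t m).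
Variables (x v : 'rV[R]_d).
Implicit Types (s : R) (z : Z).

Let r z : R := Num.sqrt (sqdist x (phi z)).
Let a : R := Num.sqrt (sqdist 0 v).
Let far z : R := (2 < r z * a)%R%:R.

Let r_ge0 z : 0 <= r z. Proof. exact: sqrtr_ge0. Qed.
Let a_ge0 : 0 <= a. Proof. exact: sqrtr_ge0. Qed.
Let far_ge0 z : 0 <= far z. Proof. exact: ler0n. Qed.

Let mr : measurable_fun setT r.
Proof. by apply: measurable_fun_sqrt; exact: measurable_sqdist. Qed.

Let mfar : measurable_fun setT far.
Proof.
have -> : far = (fun z => if 2 < r z * a then 1 else 0).
  by apply/funext => z; rewrite /far; case: ifP.
apply: measurable_fun_ifT => //.
by apply: measurable_fun_ltr => //; exact: measurable_funM.
Qed.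

Let mphi2 i : measurable_fun setT (fun p : R * Z => phi p.2 ord0 i).
Proof. exact: (measurableT_comp (mphi i) measurable_snd). Qed.

Let mfst : measurable_fun setT (fun p : R * Z => p.1).
Proof. exact: measurable_fst. Qed.

Let msqdist_ray :
  measurable_fun setT (fun p : R * Z => sqdist (x + p.1 *: v) (phi p.2)).
Proof.
apply: measurable_sqdist => // i.
have -> : (fun p : R * Z => (x + p.1 *: v) ord0 i) =
    (fun p => x ord0 i + p.1 * v ord0 i) by apply/funext => p; rewrite !mxE.
by apply: measurable_funD => //; exact: measurable_funM.
Qed.

(* On the region [2 < r z * a] the drift matters; there [gauss_peak s] is replaced
   by its majorant [t / s * gauss_peak t], the only place where [d <= 2] is essential. *)
Definition drift_far (p : R * Z) : R := far p.2 *
  (t / p.1 * pk t * expR (- (sqdist (x + p.1 *: v) (phi p.2) / (4 * p.1)))) * W p.2.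

Lemma measurable_drift_far : measurable_fun setT drift_far.
Proof.
apply: measurable_funM; last exact: (measurableT_comp mW measurable_snd).
apply: measurable_funM; first exact: (measurableT_comp mfar measurable_snd).
apply: measurable_funM.
  apply: measurable_funM => //; apply: measurable_funM => //.
  exact: measurable_funV.
by apply: measurable_expN_div => //; exact: measurable_funM.
Qed.

Lemma drift_far_ge0 s z : 0 < s -> 0 <= drift_far (s, z).
Proof.
move=> s0; apply: mulr_ge0 => //=; apply: mulr_ge0 => //.
apply: mulr_ge0; last exact: expR_ge0.
by apply: mulr_ge0; [rewrite divr_ge0// ltW|rewrite ltW// gauss_peak_gt0].
Qed.

(* Half of the exponent controls the position relative to the fixed point
   [x + s' *: v] of the ray, the other half is kept for the integral in time. *)
Lemma drift_far_split (s s' : R) z : 0 < s -> s < t -> (s - s') ^+ 2 * a ^+ 2 <= t ->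
  drift_far (s, z) <=
  t * expR 8^-1 * (pk t * expR (- (sqdist (x + s' *: v) (phi z) / (16 * t))) * W z) *
  (far z * (s^-1 * expR (- ((r z - s * a) ^+ 2 / (8 * s))))).
Proof.
move=> s0 st ss'; rewrite /drift_far /=.
set q := sqdist (x + s *: v) (phi z); set q' := sqdist (x + s' *: v) (phi z).
have q0 : 0 <= q by exact: sqdist_ge0.
have pk0 : 0 <= pk t by rewrite ltW// gauss_peak_gt0.
suff qq : expR (- (q / (4 * s))) <=
    expR 8^-1 * expR (- (q' / (16 * t))) * expR (- ((r z - s * a) ^+ 2 / (8 * s))).
  have -> : forall e1 e2 e3 : R, t * e1 * (pk t * e2 * W z) * (far z * (s^-1 * e3)) =
      far z * (t / s * pk t * (e1 * e2 * e3)) * W z by move=> *; ring.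
  apply: ler_wpM2r => //; apply: ler_wpM2l => //; apply: ler_wpM2l => //.
  by apply: mulr_ge0 => //; rewrite divr_ge0// ltW.
rewrite -!expRD ler_expR.
have q_ray : (r z - s * a) ^+ 2 <= q by exact: sqdist_to_ray_ge (ltW s0).
(* Between times [s] and [s'] the ray moves by at most [sqrt t]. Dividing by [16 * t] produces the
   [1 / 8] in the constant, and [s < t] turns [q / (8 t)] into half of the available exponent. *)
have q'_le : q' <= 2 * t + 2 * q.
  apply: (le_trans (sqdist_quasi_triangle (x + s *: v) _ _)).
  rewrite lerD2r ler_pM2l// sqdist_ray -(sqr_sqrtr (sqdist_ge0 0 v)); exact: ss'.
have tt := t0.
have h1 : (r z - s * a) ^+ 2 / (8 * s) <= q / (8 * s).
  by rewrite ler_pM2r// invr_gt0 mulr_gt0.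
have h2 : q / (8 * t) <= q / (8 * s).
  by rewrite ler_wpM2l// lef_pV2 ?posrE ?mulr_gt0// ler_pM2l// ltW.
have h3 : q' / (16 * t) <= 8^-1 + q / (8 * t).
  have -> : 8^-1 + q / (8 * t) = (2 * t + 2 * q) / (16 * t) by field; rewrite gt_eqF.
  by rewrite ler_pM2r// invr_gt0 mulr_gt0.
have -> : q / (4 * s) = q / (8 * s) + q / (8 * s) by field; rewrite gt_eqF.
lra.
Qed.

(** After the split the spatial window no longer depends on [s], so Tonelli allows integrating in
    time first, at cost [k]. The window then costs [64 / t * m], and its [t] cancels the factor [t]
    of the split. *)
Lemma drift_far_piece (D : set R) (s' k : R) : measurable D -> 0 <= k ->
  (forall s, D s -> [/\ 0 < s, s < t & (s - s') ^+ 2 * a ^+ 2 <= t]) ->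
  (forall z, 2 < r z * a ->
    (\int[leb]_(s in D) (s^-1 * expR (- ((r z - s * a) ^+ 2 / (8 * s))))%:E <= k%:E)%E) ->
  (\int[leb]_(s in D) \int[mu]_z (drift_far (s, z))%:E <=
     (k * (expR 8^-1 * 64 * m))%:E)%E.
Proof.
move=> mD k0 Dt Dk.
pose f z := pk t * expR (- (sqdist (x + s' *: v) (phi z) / (16 * t))) * W z.
pose g s z := s^-1 * expR (- ((r z - s * a) ^+ 2 / (8 * s))).
pose c := t * expR 8^-1.
have pk0 : 0 <= pk t by rewrite ltW// gauss_peak_gt0.
have c0 : 0 <= c by rewrite /c mulr_ge0 ?expR_ge0 ?(ltW t0).
have f0 z : 0 <= f z by rewrite /f !mulr_ge0 ?expR_ge0.
have g0 s z : D s -> 0 <= g s z.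
  by move=> /Dt[s0 _ _]; rewrite /g mulr_ge0 ?expR_ge0 ?invr_ge0 ?(ltW s0).
have mf : measurable_fun setT f.
  apply: measurable_funM => //; apply: measurable_funM => //.
  by apply: measurable_expN_div => //; exact: measurable_sqdist.
have mg : measurable_fun setT (fun p : R * Z => g p.1 p.2).
  apply: measurable_funM; first exact: measurable_funV.
  apply: measurable_expN_div; last exact: measurable_funM.
  apply: measurable_funX; apply: measurable_funB; last exact: measurable_funM.
  exact: (measurableT_comp mr measurable_snd).
have mfg : measurable_fun setT (fun p : R * Z => c * f p.2 * (far p.2 * g p.1 p.2)).
  apply: measurable_funM.
    by apply: measurable_funM => //; exact: (measurableT_comp mf measurable_snd).
  by apply: measurable_funM => //; exact: (measurableT_comp mfar measurable_snd).
apply: (@le_trans _ _ (\int[leb]_(s in D) \int[mu]_z (c * f z * (far z * g s z))%:E)%E).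
  apply: (le_integral_integral mu D drift_far (fun p => c * f p.2 * (far p.2 * g p.1 p.2))) => //.
    exact: measurable_drift_far.
  move=> s z /Dt[s0 st ss']; rewrite drift_far_ge0//=.
  exact: drift_far_split.
have F0 s z : D s -> 0 <= c * f z * (far z * g s z).
  by move=> Ds; apply: mulr_ge0; [exact: mulr_ge0|apply: mulr_ge0 => //; exact: g0].
rewrite (tonelli_in mu D (fun p => c * f p.2 * (far p.2 * g p.1 p.2)))//.
apply: (@le_trans _ _ (\int[mu]_z (k * c * f z)%:E)%E).
  apply: ge0_le_integral => //.
  - by move=> z _; apply: integral_ge0 => s Ds; rewrite lee_fin; exact: F0.
  - exact: (measurable_integral_fst D (fun p => c * f p.2 * (far p.2 * g p.1 p.2))).
  - by apply/measurable_EFinP; exact: measurable_funM.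
  move=> z _ /=.
  have mgz : measurable_fun setT (fun s => g s z).
    exact: (measurableT_comp mg (measurable_pair2 z)).
  under eq_integral do rewrite mulrA EFinM.
  rewrite ge0_integralZl_EFin//.
  - rewrite /far; case: ltP => [ra|_].
      rewrite mulr1 -mulrA [k * _]mulrC [leRHS]EFinM; apply: lee_wpmul2l; last exact: Dk.
      by rewrite lee_fin mulr_ge0.
    by rewrite mulr0 mul0e lee_fin -mulrA mulr_ge0// mulr_ge0.
  - by move=> s Ds; rewrite lee_fin g0.
  - by apply/measurable_EFinP; exact: measurable_funTS.
  - by apply: mulr_ge0 => //; exact: mulr_ge0.
under eq_integral do rewrite EFinM.
rewrite ge0_integralZl_EFin//; last 3 first.
- by move=> z _; rewrite lee_fin.
- exact/measurable_EFinP.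
- exact: mulr_ge0.
apply: (le_trans (lee_wpmul2l _ (kato_gauss_wide mu phi W d2 mphi mW W0 gauss1 t m t0 m0 kato_le _))).
  by rewrite lee_fin mulr_ge0.
rewrite -EFinM lee_fin le_eqVlt; apply/orP; left; apply/eqP; rewrite /c.
by field; rewrite gt_eqF.
Qed.

Lemma drift_far_le :
  (\int[leb]_(s in `]0%R, t[) \int[mu]_z (drift_far (s, z))%:E <=
     (40 * pi * (expR 8^-1 * 64 * m))%:E)%E.
Proof.
set K := expR 8^-1 * 64 * m.
have K0 : 0 <= K by rewrite /K !mulr_ge0 ?expR_ge0.
(* Without drift the far region is empty; otherwise division by [a] is legitimate below. *)
have [a0|] := ltP 0 a; last first.
  move=> a0; have {}a0 : a = 0 by apply/le_anti; rewrite a0 a_ge0.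
  rewrite integral0_eq => [|s _]; first by rewrite lee_fin !mulr_ge0 ?pi_ge0.
  rewrite integral0_eq// => z _.
  by rewrite /drift_far /= /far a0 mulr0 ltrn0 /= !mul0r.
pose h := Num.sqrt t / a.
have h0 : 0 < h by rewrite divr_gt0// sqrtr_gt0.
have ha : h ^+ 2 * a ^+ 2 = t.
  by rewrite -exprMn /h divfK ?gt_eqF// sqr_sqrtr// ltW.
(* Right end of the [n]-th piece, capped at [t]; late pieces may be empty. *)
pose b n := Num.min t (n.+1%:R * h).
have b_gt0 n : 0 < b n by rewrite lt_min t0 mulr_gt0.
have b_nd n : b n <= b n.+1.
  by rewrite le_min ge_min lexx/= ge_min ler_pM2r// ler_nat leqnSn orbT.
have nonneg s : 0 < s -> (0 <= \int[mu]_z (drift_far (s, z))%:E)%E.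
  by move=> s0; apply: integral_ge0 => z _; rewrite lee_fin drift_far_ge0.
have pi0 := pi_gt0 R.
(* Partial sums: [8 * pi] for the first piece, and [16 * pi / (a * sqrt (k * h))] for each [k] from
   1 to [n], telescoped into [32 * pi * sqrt n / (a * sqrt h)]. *)
have main n : (\int[leb]_(s in `]0%R, b n[) \int[mu]_z (drift_far (s, z))%:E <=
     ((8 * pi + 32 * pi * Num.sqrt n%:R / (a * Num.sqrt h)) * K)%:E)%E.
  elim: n => [|n ih].
    rewrite sqrtr0 mulr0 mul0r addr0; apply: (@drift_far_piece _ 0) => //.
    - by rewrite mulr_ge0 ?ltW.
    - move=> s /=; rewrite in_itv /= lt_min mul1r => /andP[s0 /andP[st sh]].
      split=> //; rewrite subr0 -ha ler_pM2r ?exprn_gt0//.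
      by rewrite ler_pXn2r ?nnegrE ?ltW.
    - move=> z ra; apply: integral_drift_near_le => //; last exact: ltW.
      by move=> s /=; rewrite !in_itv /= andbT => /andP[].
  have -> : `]0, b n.+1[%classic = `]0, b n[ `|` `[b n, b n.+1[ :> set R.
    by rewrite -itv_bndbnd_setU// bnd_simp// ltW.
  have sub s : (`]0, b n[ `|` `[b n, b n.+1[)%classic s -> 0 < s.
    case; rewrite /= in_itv /= => /andP[] //.
    by move=> bs _; exact: lt_le_trans bs.
  rewrite ge0_integral_setU//; last 3 first.
  - apply: (measurable_integral_snd mu _ drift_far) => //.
    + exact: measurableU.
    + exact: measurable_drift_far.
    + by move=> s z /sub; exact: drift_far_ge0.
  - by move=> s /sub; exact: nonneg.
  - apply/disj_setPS => s [] /=; rewrite !in_itv /= => /andP[_ sb] /andP[bs _].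
    by have := lt_le_trans sb bs; rewrite ltxx.
  have s1_gt0 : 0 < n.+1%:R * h by rewrite mulr_gt0.
  (* Since [s < t], the inequality [b n <= s] can only come from the second argument of the
     minimum. *)
  have piece s : `[b n, b n.+1[%classic s -> [/\ s < t, n.+1%:R * h <= s & s < n.+2%:R * h].
    rewrite /= in_itv /= lt_min => /andP[bs /andP[st sn]]; split => //.
    by move: bs; rewrite ge_min leNgt st.
  have step : (\int[leb]_(s in `[b n, b n.+1[) \int[mu]_z (drift_far (s, z))%:E <=
      (16 * pi / (a * Num.sqrt (n.+1%:R * h)) * K)%:E)%E.
    apply: (@drift_far_piece _ (n.+1%:R * h)) => //.
    - by rewrite divr_ge0 ?mulr_ge0 ?sqrtr_ge0 ?ltW.
    - move=> s /piece[st s1s s2s]; split => //; first exact: lt_le_trans s1s.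
      rewrite -ha ler_pM2r ?exprn_gt0//.
      rewrite ler_pXn2r ?nnegrE ?subr_ge0 ?(ltW h0)//.
      by rewrite lerBlDl -[X in _ <= _ + X]mul1r -mulrDl natr1 ltW.
    - move=> z _; apply: integral_drift_far_le => //.
      by move=> s /piece[_ s1s _] /=; rewrite in_itv /= s1s.
  apply: (le_trans (leeD ih step)); rewrite -EFinD lee_fin -mulrDl ler_wpM2r//.
  rewrite -addrA lerD2l (sqrtrM h (ler0n R n.+1)).
  have -> : 16 * pi / (a * (Num.sqrt n.+1%:R * Num.sqrt h)) =
      16 * pi * (Num.sqrt n.+1%:R)^-1 / (a * Num.sqrt h).
    by rewrite mulrCA invfM mulrA.
  rewrite -mulrDl ler_wpM2r ?invr_ge0 ?mulr_ge0 ?sqrtr_ge0//.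
  by have := ler_wpM2l (ltW pi0) (invsqrt_le_telescope n); lra.
(* The pieces up to [N] reach [t], because [t / h < N + 1]. Moreover [N <= t / h = a^2 h], so the
   sum is at most [8 * pi + 32 * pi]. *)
pose N := Num.truncn (t / h).
have th0 : 0 <= t / h by rewrite divr_ge0 ?ltW.
have <- : b N = t by rewrite /b min_l// -ler_pdivrMr// ltW// truncnS_gt.
apply: (le_trans (main N)); rewrite lee_fin ler_wpM2r//.
suff : Num.sqrt N%:R / (a * Num.sqrt h) <= 1.
  by move=> /(ler_wpM2l (ltW pi0)); lra.
have sh0 : 0 < Num.sqrt h by rewrite sqrtr_gt0.
rewrite ler_pdivrMr ?mulr_gt0// mul1r.
rewrite -(@ler_pXn2r _ 2) ?nnegrE ?mulr_ge0 ?sqrtr_ge0// exprMn.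
rewrite (sqr_sqrtr (ltW h0)) sqr_sqrtr//.
apply: (@le_trans _ _ (t / h)); first by rewrite truncn_le.
by rewrite ler_pdivrMr// -ha expr2 mulrC mulrA.
Qed.

(** Integrate [gauss_drift_le]: the driftless term is bounded by the Kato integral at [x], the other
    by [drift_far_le]. Both bounds live on []0, t[], hence the enlargement of the time interval. *)
Lemma half_ray_le :
  (\int[leb]_(s in `]0%R, (t / 2)%R]) \int[mu]_z (gauss s (x + s *: v) (phi z) * W z)%:E
    <= (expR 1 * m + 40 * pi * (expR 8^-1 * 64 * m))%:E)%E.
Proof.
pose F p := expR 1 * (gauss p.1 x (phi p.2) * W p.2).
have F0 p : 0 <= F p.
  by apply: mulr_ge0; [exact: expR_ge0|rewrite mulr_ge0 ?gauss_ge0].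
have mF : measurable_fun setT F.
  by apply: measurable_funM => //; exact: measurable_kato_integrand.
have mFD : measurable_fun setT (fun p => F p + drift_far p).
  by apply: measurable_funD => //; exact: measurable_drift_far.
have tpos s : `]0, t[%classic s -> 0 < s by rewrite /= in_itv /= => /andP[].
apply: (@le_trans _ _ (\int[leb]_(s in `]0%R, t[) \int[mu]_z (F (s, z) + drift_far (s, z))%:E)%E).
  apply: (@le_trans _ _ (\int[leb]_(s in `]0%R, (t / 2)%R]) \int[mu]_z (F (s, z) + drift_far (s, z))%:E)%E).
    apply: (le_integral_integral mu _ (fun p => gauss p.1 (x + p.1 *: v) (phi p.2) * W p.2)
       (fun p => F p + drift_far p)) => //.
      apply: measurable_funM; last exact: (measurableT_comp mW measurable_snd).
      apply: measurable_funM.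
        have m4 : measurable_fun setT (fun p : R * Z => 4 * pi * p.1) by exact: measurable_funM.
        exact: (measurableT_comp (measurable_powR _) m4).
      by apply: measurable_expN_div => //; exact: measurable_funM.
    move=> s z /=; rewrite in_itv /= => /andP[s0 st].
    have st' : s <= t by have := t0; lra.
    rewrite mulr_ge0 ?gauss_ge0//= /F /drift_far /= mulrA -mulrDl ler_wpM2r//.
    exact: gauss_drift_le.
  apply: ge0_subset_integral => //.
  - apply: (measurable_integral_snd mu _ (fun p => F p + drift_far p)) => // s z /tpos s0.
    by rewrite addr_ge0// drift_far_ge0.
  - move=> s /tpos s0; apply: integral_ge0 => z _.
    by rewrite lee_fin addr_ge0// drift_far_ge0.
  - move=> s /=; rewrite !in_itv /= => /andP[-> st] /=; have := t0; lra.
have mFz s : measurable_fun setT (fun z => (F (s, z))%:E).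
  by apply/measurable_EFinP; exact: (measurableT_comp mF (measurable_pair1 s)).
rewrite (_ : \int[leb]_(s in _) _ = \int[leb]_(s in `]0%R, t[)
    (\int[mu]_z (F (s, z))%:E + \int[mu]_z (drift_far (s, z))%:E))%E; last first.
  apply: eq_integral => s; rewrite inE => /tpos s0.
  under eq_integral do rewrite EFinD.
  rewrite ge0_integralD//.
  - by move=> z _; rewrite lee_fin.
  - by move=> z _; rewrite lee_fin drift_far_ge0.
  - by apply/measurable_EFinP; exact: (measurableT_comp measurable_drift_far (measurable_pair1 s)).
rewrite ge0_integralD//; last 4 first.
- by move=> s _; apply: integral_ge0 => z _; rewrite lee_fin.
- exact: (measurable_integral_snd mu _ F).
- by move=> s /tpos s0; apply: integral_ge0 => z _; rewrite lee_fin drift_far_ge0.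
- apply: (measurable_integral_snd mu _ drift_far) => //; first exact: measurable_drift_far.
  by move=> s z /tpos; exact: drift_far_ge0.
rewrite EFinD; apply: leeD; last exact: drift_far_le.
rewrite EFinM; apply: le_trans (lee_wpmul2l _ (kato_le x)); last first.
  by rewrite lee_fin expR_ge0.
rewrite -ge0_integralZl_EFin ?expR_ge0//; last 2 first.
- move=> s _; apply: integral_ge0 => z _.
  by rewrite lee_fin mulr_ge0 ?gauss_ge0.
- apply: (measurable_integral_snd mu _ (fun p => gauss p.1 x (phi p.2) * W p.2)) => //.
    exact: measurable_kato_integrand.
  by move=> s z _; rewrite mulr_ge0 ?gauss_ge0.
rewrite le_eqVlt; apply/orP; left; apply/eqP; apply: eq_integral => s _.
rewrite /F; under eq_integral do rewrite EFinM.
rewrite ge0_integralZl_EFin ?expR_ge0//.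
- by move=> z _; rewrite lee_fin mulr_ge0 ?gauss_ge0.
- apply/measurable_EFinP.
  exact: (measurableT_comp (measurable_kato_integrand phi W mphi mW x) (measurable_pair1 s)).
Qed.

End half_bridge.

(** * Bridge integrals against Kato integrals, in both directions *)

Section bridge_integrals.
Context {R : realType} {d : nat} {dZ : measure_display} {Z : measurableType dZ}.
Variables (mu : {sigma_finite_measure set Z -> \bar R}).
Variables (phi : Z -> 'rV[R]_d) (W : Z -> R).
Hypotheses (d2 : (d <= 2)%N).
Hypothesis mphi : forall i, measurable_fun setT (fun z => phi z ord0 i).
Hypotheses (mW : measurable_fun setT W) (W0 : forall z, 0 <= W z).
Hypothesis gauss1 : forall t x, 0 < t -> (\int[mu]_z (gauss t x (phi z))%:E = 1)%E.
Notation leb := (@lebesgue_measure R).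
Implicit Types (x y : 'rV[R]_d) (s t m : R).

Let bridge t x y s z : R :=
  gauss s x (phi z) * gauss (t - s) (phi z) y / gauss t x y * W z.

Let bridge_ge0 t x y s z : 0 <= bridge t x y s z.
Proof.
apply: mulr_ge0 => //; apply: divr_ge0; last exact: gauss_ge0.
by apply: mulr_ge0; exact: gauss_ge0.
Qed.

Let mphi2 i : measurable_fun setT (fun p : R * Z => phi p.2 ord0 i).
Proof. exact: (measurableT_comp (mphi i) measurable_snd). Qed.

Let mfst : measurable_fun setT (fun p : R * Z => p.1).
Proof. exact: measurable_fst. Qed.

Let mbridge t x y : measurable_fun setT (fun p : R * Z => bridge t x y p.1 p.2).
Proof.
apply: measurable_funM; last exact: (measurableT_comp mW measurable_snd).
apply: measurable_funM => //; apply: measurable_funM; apply: measurable_gauss => //.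
exact: measurable_funB.
Qed.

Lemma half_bridge_le t m x y : 0 < t -> 0 <= m -> kato_bound mu phi W t m ->
  (\int[leb]_(s in `]0%R, (t / 2)%R]) \int[mu]_z (bridge t x y s z)%:E
    <= (2 * (expR 1 * m + 40 * pi * (expR 8^-1 * 64 * m)))%:E)%E.
Proof.
move=> t0 m0 kato_le; pose v := t^-1 *: (y - x).
pose ray (p : R * Z) := gauss p.1 (x + p.1 *: v) (phi p.2) * W p.2.
have mray : measurable_fun setT ray.
  apply: measurable_funM; last exact: (measurableT_comp mW measurable_snd).
  apply: measurable_gauss => // i.
  have -> : (fun p : R * Z => (x + p.1 *: v) ord0 i) =
    (fun p => x ord0 i + p.1 * v ord0 i) by apply/funext => p; rewrite !mxE.
  by apply: measurable_funD => //; exact: measurable_funM.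
have ray0 p : 0 <= ray p by rewrite mulr_ge0 ?gauss_ge0.
apply: (@le_trans _ _ (\int[leb]_(s in `]0%R, (t / 2)%R]) \int[mu]_z (2 * ray (s, z))%:E)%E).
  apply: (le_integral_integral mu _ (fun p => bridge t x y p.1 p.2) (fun p => 2 * ray p)) => //.
    exact: measurable_funM.
  move=> s z /=; rewrite in_itv /= => /andP[s0 st]; rewrite bridge_ge0/=.
  rewrite mulrA ler_wpM2r//; exact: bridge_le.
rewrite [leRHS]EFinM.
apply: le_trans (lee_wpmul2l _ (half_ray_le mu phi W d2 mphi mW W0 gauss1 t m t0 m0 kato_le x v)); last first.
  by rewrite lee_fin.
rewrite -ge0_integralZl_EFin//; last 2 first.
- by move=> s _; apply: integral_ge0 => z _; rewrite lee_fin; exact: (ray0 (s, z)).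
- exact: (measurable_integral_snd mu _ ray).
rewrite le_eqVlt; apply/orP; left; apply/eqP; apply: eq_integral => s _.
under eq_integral do rewrite EFinM.
rewrite ge0_integralZl_EFin//.
- by move=> z _; rewrite lee_fin.
- by apply/measurable_EFinP; exact: (measurableT_comp mray (measurable_pair1 s)).
Qed.

(** The substitution of [t - s] for [s] exchanges the endpoints, so the second half of the bridge
    from [x] to [y] is the first half of the bridge from [y] to [x]. The Kato bound is uniform in
    the starting point and serves both. *)
Lemma bridge_integral_le t m x y : 0 < t -> 0 <= m -> kato_bound mu phi W t m ->
  (\int[leb]_(s in `]0%R, t[) \int[mu]_z (bridge t x y s z)%:E
    <= (4 * (expR 1 * m + 40 * pi * (expR 8^-1 * 64 * m)))%:E)%E.
Proof.
move=> t0 m0 kato_le; set C := _ + _.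
have t2 : 0 < t / 2 by rewrite divr_gt0.
have t2t : t / 2 < t by lra.
have I0 x' y' s : (0 <= \int[mu]_z (bridge t x' y' s z)%:E)%E.
  by apply: integral_ge0 => z _; rewrite lee_fin.
have mI x' y' : measurable_fun setT (fun s => \int[mu]_z (bridge t x' y' s z)%:E)%E.
  exact: (measurable_integral_snd mu setT (fun p => bridge t x' y' p.1 p.2)).
have -> : `]0%R, t[%classic = `]0, t / 2] `|` `]t / 2, t[ :> set R.
  by rewrite -itv_bndbnd_setU// bnd_simp// ltW.
rewrite ge0_integral_setU//; last 2 first.
- by apply: measurable_funTS; exact: mI.
- apply/disj_setPS => s [] /=; rewrite !in_itv /= => /andP[_ sb] /andP[bs _].
  by have := lt_le_trans bs sb; rewrite ltxx.
have -> : (4 * C)%:E = ((2 * C)%:E + (2 * C)%:E)%E by rewrite -EFinD; congr _%:E; ring.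
apply: leeD; first exact: half_bridge_le.
rewrite (integral_reflection t)//.
apply: le_trans (half_bridge_le _ _ y x t0 m0 kato_le).
rewrite (_ : [set s | _] = `]0, t / 2[%classic :> set R); last first.
  by apply/seteqP; split => s /=; rewrite !in_itv /= => /andP[? ?]; apply/andP; split; lra.
under eq_integral => s _.
  under eq_integral => z _.
    have -> : bridge t x y (t - s) z = bridge t y x s z.
      rewrite /bridge subKr (gaussC t) (gaussC (t - s)) (gaussC s _ y).
      by rewrite [gauss (t - s) _ _ * _]mulrC.
    over.
  over.
apply: ge0_subset_integral => //.
- by apply: measurable_funTS; exact: mI.
- by move=> s /=; rewrite !in_itv /= => /andP[-> /ltW].
Qed.

(** Average the bound over the endpoint [w] with the probability density [gauss t x]: this cancels
    the normalisation of the bridge, and integrating [w] out leaves [gauss s x]. *)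
Lemma kato_le_bridge t (K : R) x : 0 < t -> 0 <= K ->
  (forall y, \int[leb]_(s in `]0%R, t[) \int[mu]_z (bridge t x y s z)%:E <= K%:E)%E ->
  (\int[leb]_(s in `]0%R, t[) \int[mu]_z (gauss s x (phi z) * W z)%:E <= K%:E)%E.
Proof.
move=> t0 K0 bK; pose f s z w := gauss s x (phi z) * W z * gauss (t - s) (phi z) (phi w).
have f0 s z w : 0 <= f s z w.
  by apply: mulr_ge0; [rewrite mulr_ge0 ?gauss_ge0|exact: gauss_ge0].
have mf : measurable_fun setT (fun p : (R * Z) * Z => f p.1.1 p.1.2 p.2).
  have m11 : measurable_fun setT (fun p : (R * Z) * Z => p.1.1).
    exact: (measurableT_comp measurable_fst measurable_fst).
  have m12 : measurable_fun setT (fun p : (R * Z) * Z => p.1.2).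
    exact: (measurableT_comp measurable_snd measurable_fst).
  apply: measurable_funM.
    apply: measurable_funM; last exact: (measurableT_comp mW m12).
    by apply: measurable_gauss => // i; exact: (measurableT_comp (mphi i) m12).
  apply: measurable_gauss => [|i|i]; first exact: measurable_funB.
    exact: (measurableT_comp (mphi i) m12).
  exact: (measurableT_comp (mphi i) measurable_snd).
have mfs s : measurable_fun setT (fun p : Z * Z => (f s p.1 p.2)%:E).
  apply/measurable_EFinP.
  apply: (measurableT_comp (f := fun p : (R * Z) * Z => f p.1.1 p.1.2 p.2)
    (g := fun p : Z * Z => ((s, p.1), p.2)) mf).
  apply: measurable_fun_pair; last exact: measurable_snd.
  by apply: measurable_fun_pair => //; exact: measurable_fst.
pose G (q : R * Z) := (\int[mu]_z (f q.1 z q.2)%:E)%E.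
have G0 q : (0 <= G q)%E by apply: integral_ge0 => z _; rewrite lee_fin.
have mG : measurable_fun setT G.
  have mf' : measurable_fun setT (fun p : (R * Z) * Z => (f p.1.1 p.2 p.1.2)%:E).
    apply/measurable_EFinP.
    apply: (measurableT_comp (f := fun p : (R * Z) * Z => f p.1.1 p.1.2 p.2)
      (g := fun p : (R * Z) * Z => ((p.1.1, p.2), p.1.2)) mf).
    apply: measurable_fun_pair; last exact: (measurableT_comp measurable_snd measurable_fst).
    apply: measurable_fun_pair; last exact: measurable_snd.
    exact: (measurableT_comp measurable_fst measurable_fst).
  by apply: (measurable_fun_fubini_tonelli_F _ mf') => p; rewrite lee_fin.
(* The indicator confines time to []0, t[], where [gauss (t - s)] has mass one, while Tonelli is
   applied over the whole line. *)
pose H (q : R * Z) := (G q * (\1_(`]0, t[%classic : set R) q.1)%:E)%E.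
have mH : measurable_fun setT H.
  apply: emeasurable_funM => //; apply/measurable_EFinP.
  by apply: (measurableT_comp _ measurable_fst); exact: measurable_indic.
have H0 q : (0 <= H q)%E by rewrite mule_ge0// lee_fin.
have -> : (\int[leb]_(s in `]0%R, t[) \int[mu]_z (gauss s x (phi z) * W z)%:E =
    \int[leb]_s \int[mu]_w H (s, w))%E.
  rewrite integral_mul_indic; apply: eq_integral => s _.
  rewrite /H /= indicE; case: (boolP (s \in _)) => [|_]; last first.
    by rewrite mule0 integral0_eq// => w _; rewrite mule0.
  rewrite inE /= in_itv /= => /andP[s0 st]; rewrite mule1.
  under [RHS]eq_integral do rewrite mule1.
  rewrite -(fubini_tonelli _ (mfs s)); last by move=> p; rewrite lee_fin.
  apply: eq_integral => z _; rewrite /f /=.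
  under eq_integral do rewrite EFinM.
  rewrite ge0_integralZl_EFin ?gauss1 ?mule1 ?subr_gt0//.
  - by move=> w _; rewrite lee_fin gauss_ge0.
  - by apply/measurable_EFinP; exact: measurable_gauss_phi.
  - by rewrite mulr_ge0 ?gauss_ge0.
have -> := @fubini_tonelli _ _ _ _ _ leb mu H mH H0.
apply: (@le_trans _ _ (\int[mu]_w (K * gauss t x (phi w))%:E)%E).
  apply: ge0_le_integral => //.
  - by move=> w _; exact: integral_ge0.
  - exact: (@measurable_fun_fubini_tonelli_G _ _ _ _ _ leb H mH H0).
  - by apply/measurable_EFinP; apply: measurable_funM => //; exact: measurable_gauss_phi.
  move=> w _; rewrite -integral_mul_indic.
  have g0 : 0 < gauss t x (phi w) by exact: gauss_gt0.
  (* [f] is the bridge integrand with endpoint [phi w] multiplied by its denominator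
     [gauss t x (phi w)]. *)
  have -> : (\int[leb]_(s in `]0%R, t[) G (s, w) = \int[leb]_(s in `]0%R, t[)
      ((gauss t x (phi w))%:E * \int[mu]_z (bridge t x (phi w) s z)%:E))%E.
    apply: eq_integral => s _.
    rewrite -ge0_integralZl_EFin ?(ltW g0)//; last 2 first.
    - by move=> z _; rewrite lee_fin.
    - apply/measurable_EFinP.
      exact: (measurableT_comp (mbridge t x (phi w)) (measurable_pair1 s)).
    apply: eq_integral => z _; rewrite -EFinM /f /bridge; congr _%:E.
    by field; rewrite gt_eqF.
  rewrite ge0_integralZl_EFin ?(ltW g0)//; last 2 first.
  - by move=> s _; apply: integral_ge0 => z _; rewrite lee_fin.
  - exact: (measurable_integral_snd mu _ (fun p => bridge t x (phi w) p.1 p.2)).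
  by rewrite mulrC [leRHS]EFinM lee_wpmul2l ?lee_fin ?(ltW g0).
under eq_integral do rewrite EFinM.
rewrite ge0_integralZl_EFin ?gauss1 ?mule1//.
- by move=> w _; rewrite lee_fin gauss_ge0.
- by apply/measurable_EFinP; exact: measurable_gauss_phi.
Qed.

End bridge_integrals.

(** * Dimensions one and two *)

Section sigma_finite_prod.
Context {d1 d2 : measure_display} {T1 : measurableType d1} {T2 : measurableType d2}.
Context {R : realType}.
Variables (m1 : {sigma_finite_measure set T1 -> \bar R}).
Variables (m2 : {sigma_finite_measure set T2 -> \bar R}).

(* An alias is needed: on [m1 \x m2] itself, canonical inference only knows the
   sigma-finite structure of products of subprobabilities. *)
Definition sigma_finite_prod := (m1 \x m2)%E.

HB.instance Definition _ := Measure.on sigma_finite_prod.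

Let sigma_finite_prodT : sigma_finite setT sigma_finite_prod.
Proof.
exact: (@isSigmaFinite.sigma_finiteT _ _ _ _
  (measure_function_Measure_isSigmaFinite__to__measure_function_isSigmaFinite m1 m2)).
Qed.

HB.instance Definition _ :=
  Measure_isSigmaFinite.Build _ _ _ sigma_finite_prod sigma_finite_prodT.

End sigma_finite_prod.

(** * Models of the line and the plane, and transfer to the two norms *)

Section models.
Context {R : realType}.
Notation leb := (@lebesgue_measure R).

(** The kernel has variance [2 * t], not [t]. Its mass one then comes from that of the normal
    density. *)
Lemma gauss1E t x y : 0 < t ->
  @gauss R 1 t x y = normal_pdf (x ord0 ord0) (Num.sqrt (2 * t)) (y ord0 ord0).
Proof.
move=> t0; have s0 : Num.sqrt (2 * t) != 0 by rewrite gt_eqF// sqrtr_gt0 mulr_gt0.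
have s2 : Num.sqrt (2 * t) ^+ 2 = 2 * t by rewrite sqr_sqrtr// mulr_ge0// ltW.
rewrite normal_pdfE// /= /normal_peak /normal_fun /gauss s2.
rewrite /sqdist big_ord1 powRN div1r powR12_sqrt ?mulr_ge0 ?pi_ge0 ?ltW//.
congr (_ * expR _); last by rewrite mulNr; congr (- (_ / _)); ring.
by congr (Num.sqrt _)^-1; ring.
Qed.

(** This is literally the vector obtained by unfolding [intRd], empty tail included, so the two
    integrals agree by computation; the same holds for [point2]. *)
Definition point1 (a : R) : 'rV[R]_1 := row_mx (const_mx a : 'rV[R]_1) (0 : 'rV[R]_0).

Lemma point1E a i : point1 a ord0 i = a.
Proof.
have -> : i = lshift 0 (ord0 : 'I_1) by apply/val_inj; rewrite /= ord1.
by rewrite /point1 (row_mxEl (const_mx a : 'rV[R]_1) (0 : 'rV[R]_0)) mxE.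
Qed.

Definition point2 (p : R * R) : 'rV[R]_2 :=
  row_mx (const_mx p.1 : 'rV[R]_1) (row_mx (const_mx p.2 : 'rV[R]_1) (0 : 'rV[R]_0)).

Lemma point2E0 p : point2 p ord0 ord0 = p.1.
Proof.
have -> : ord0 = lshift 1 (ord0 : 'I_1) :> 'I_2 by apply/val_inj.
by rewrite /point2 (row_mxEl (const_mx p.1 : 'rV[R]_1)) mxE.
Qed.

Lemma point2E1 p : point2 p ord0 (lift ord0 ord0) = p.2.
Proof.
have -> : lift ord0 ord0 = rshift 1 (ord0 : 'I_1) :> 'I_2 by apply/val_inj.
rewrite /point2 (row_mxEr (const_mx p.1 : 'rV[R]_1)).
by rewrite -/(point1 p.2) point1E.
Qed.

Lemma intRd2E (f : 'rV[R]_2 -> \bar R) :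
  intRd f = (\int[leb]_a \int[leb]_b f (point2 (a, b)))%E.
Proof. by []. Qed.

Lemma gauss_point1 t x : 0 < t -> (\int[leb]_a (@gauss R 1 t x (point1 a))%:E = 1)%E.
Proof.
move=> t0; under eq_integral do rewrite gauss1E// point1E.
exact: integral_normal_pdf.
Qed.

Lemma gauss2E t (x y : 'rV[R]_2) : 0 < t ->
  gauss t x y = @gauss R 1 t (point1 (x ord0 ord0)) (point1 (y ord0 ord0)) *
    @gauss R 1 t (point1 (x ord0 (lift ord0 ord0))) (point1 (y ord0 (lift ord0 ord0))).
Proof.
move=> t0; rewrite /gauss /sqdist big_ord_recl !big_ord1 !point1E mulrACA -expRD.
have p0 : 4 * pi * t != 0 by rewrite gt_eqF// !mulr_gt0// pi_gt0.
rewrite -powRD ?p0 ?implybT//.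
congr (_ `^ _ * expR _); first by field.
by field; rewrite gt_eqF.
Qed.

Lemma measurable_point1 i : measurable_fun setT (fun a => point1 a ord0 i).
Proof. by under eq_fun do rewrite point1E; exact: measurable_id. Qed.

Lemma measurable_point2 i : measurable_fun setT (fun p => point2 p ord0 i).
Proof.
case: (unliftP ord0 i) => [j ->|->].
  by rewrite (ord1 j); under eq_fun do rewrite point2E1; exact: measurable_snd.
by under eq_fun do rewrite point2E0; exact: measurable_fst.
Qed.

Lemma gauss_point2 t x : 0 < t ->
  (\int[leb \x leb]_p (@gauss R 2 t x (point2 p))%:E = 1)%E.
Proof.
move=> t0.
rewrite fubini_tonelli1; last 2 first.
- apply/measurable_EFinP; apply: measurable_gauss => // i; exact: measurable_point2.
- by move=> p; rewrite lee_fin gauss_ge0.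
rewrite /fubini_F -[RHS](gauss_point1 t (point1 (x ord0 ord0)) t0).
apply: eq_integral => a _.
under eq_integral do rewrite gauss2E// point2E0 point2E1 EFinM /=.
rewrite ge0_integralZl_EFin ?gauss_ge0 ?gauss_point1 ?mule1//.
- by move=> b _; rewrite lee_fin gauss_ge0.
- apply/measurable_EFinP; apply: measurable_gauss => // i; exact: measurable_point1.
Qed.

(** The sets with measurable preimage under [phi] form a sigma-algebra containing the generators of
    [borel_Rd]. *)
Lemma measurable_borel_comp d dT (T : measurableType dT) (phi : T -> 'rV[R]_d)
    (V : 'rV[R]_d -> R) :
  (forall i, measurable_fun setT (fun z => phi z ord0 i)) -> borel_fun V ->
  measurable_fun setT (V \o phi).
Proof.
move=> mphi bV _ B mB; rewrite setTI.
have : @borel_Rd R d `<=` [set A | measurable (phi @^-1` A)].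
  apply: smallest_sub.
    split => /=.
    - by rewrite preimage_set0.
    - by move=> A mA; rewrite setTD preimage_setC; exact: measurableC.
    - by move=> A mA; rewrite preimage_bigcup; exact: bigcup_measurable.
  move=> _ [i [C [mC ->]]] /=.
  have := mphi i measurableT C mC; rewrite setTI; exact.
by move/(_ _ (bV B mB)).
Qed.


(** The lower bound holds with constant 1; nonnegativity is recorded so that it can be weakened to a
    constant below 1. *)
Definition Snorm_Kato_comparable (d : nat) (T : R) (V : 'rV[R]_d -> R) : Prop :=
  [/\ (0 <= Kato V T)%E, (Kato V T <= Snorm V T)%E &
  (Snorm V T <= (4 * (expR 1 + 40 * pi * (expR 8^-1 * 64)))%:E * Kato V T)%E].

Lemma Snorm_Kato_comparable_of_model {d : nat} {dZ} {Z : measurableType dZ}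
    (mu : {sigma_finite_measure set Z -> \bar R}) (phi : Z -> 'rV[R]_d) (T : R)
    (V : 'rV[R]_d -> R) : (d <= 2)%N ->
  (forall i, measurable_fun setT (fun z => phi z ord0 i)) ->
  (forall t x, 0 < t -> (\int[mu]_z (gauss t x (phi z))%:E = 1)%E) ->
  (forall f : 'rV[R]_d -> R, measurable_fun setT (f \o phi) -> (forall x, 0 <= f x) ->
    intRd (fun x => (f x)%:E) = (\int[mu]_z (f (phi z))%:E)%E) ->
  0 < T -> borel_fun V -> Snorm_Kato_comparable d T V.
Proof.
move=> d2 mphi gauss1 intE T0 bV; pose W z := `|V (phi z)|.
have mW : measurable_fun setT W.
  by apply: measurableT_comp => //; exact: measurable_borel_comp.
have W0 z : 0 <= W z by exact: normr_ge0.
have katoE t x : (\int[leb]_(s in `]0%R, t[) intRd (fun z => (gauss s x z * `|V z|)%:E) =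
    \int[leb]_(s in `]0%R, t[) \int[mu]_z (gauss s x (phi z) * W z)%:E)%E.
  apply: eq_integral => s _; rewrite (intE (fun z => gauss s x z * `|V z|))//.
    by apply: measurable_funM => //; exact: measurable_gauss_phi.
  by move=> z; rewrite mulr_ge0 ?gauss_ge0.
have SE t x y : Sfun V t x y = (\int[leb]_(s in `]0%R, t[) \int[mu]_z
    (gauss s x (phi z) * gauss (t - s) (phi z) y / gauss t x y * W z)%:E)%E.
  apply: eq_integral => s _.
  rewrite (intE (fun z => gauss s x z * gauss (t - s) z y / gauss t x y * `|V z|))//.
    apply: measurable_funM => //; apply: measurable_funM => //.
    by apply: measurable_funM; exact: measurable_gauss.
  move=> z; apply: mulr_ge0 => //; apply: divr_ge0; last exact: gauss_ge0.
  by apply: mulr_ge0; exact: gauss_ge0.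
have int_ge0 t (F : R * Z -> R) : (forall p, 0 <= F p) ->
    (0 <= \int[leb]_(s in `]0%R, t[) \int[mu]_z (F (s, z))%:E)%E.
  by move=> F0; do 2!apply: integral_ge0 => ? _; rewrite lee_fin.
have kato_le x : (\int[leb]_(s in `]0%R, T[) \int[mu]_z (gauss s x (phi z) * W z)%:E <= Kato V T)%E.
  by rewrite -katoE; apply: ereal_sup_ubound; exists x.
have S_le x y : (Sfun V T x y <= Snorm V T)%E.
  by apply: ereal_sup_ubound; exists T, x, y; rewrite /= in_itv /= T0 lexx.
have kato0 : (0 <= Kato V T)%E.
  apply: le_trans (kato_le 0); apply: (int_ge0 _ (fun p => gauss p.1 0 (phi p.2) * W p.2)) => p.
  by rewrite mulr_ge0 ?gauss_ge0.
have S0 : (0 <= Snorm V T)%E.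
  apply: le_trans (S_le 0 0); rewrite SE.
  apply: (int_ge0 _ (fun p => gauss p.1 0 (phi p.2) * gauss (T - p.1) (phi p.2) 0 / gauss T 0 0 * W p.2)) => p.
  apply: mulr_ge0 => //; apply: divr_ge0; last exact: gauss_ge0.
  by apply: mulr_ge0; exact: gauss_ge0.
split=> //.
  (* The model estimates take real bounds, so infinite suprema are set apart, here and for the upper
     bound. *)
  have [Soo|SNoo] := eqVneq (Snorm V T) +oo%E; first by rewrite Soo leey.
  have /fineK SK : Snorm V T \is a fin_num by rewrite ge0_fin_numE// ltey.
  apply: ge_ereal_sup => _ [x _ <-]; rewrite katoE -SK.
  apply: (kato_le_bridge mu phi W mphi mW W0 gauss1) => //; first exact: fine_ge0.
  by move=> y; rewrite SK -SE.
have C0 : 0 < 4 * (expR 1 + 40 * pi * (expR 8^-1 * 64)) :> R.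
  by rewrite mulr_gt0// addr_gt0 ?expR_gt0// !mulr_gt0 ?expR_gt0 ?pi_gt0.
have [Koo|KNoo] := eqVneq (Kato V T) +oo%E; first by rewrite Koo gt0_muley ?leey ?lte_fin.
have /fineK KK : Kato V T \is a fin_num by rewrite ge0_fin_numE// ltey.
apply: ge_ereal_sup => _ [t [x [y [tT ->]]]].
move: tT; rewrite /= in_itv /= => /andP[t0 tT].
(* As [t <= T] and the integrand is nonnegative, the bound for [T] serves all shorter times. *)
have bound : kato_bound mu phi W t (fine (Kato V T)).
  move=> x'; rewrite KK; apply: le_trans (kato_le x').
  have g0 s z : 0 <= gauss s x' (phi z) * W z by rewrite mulr_ge0 ?gauss_ge0.
  apply: ge0_subset_integral => //.
  - apply: (measurable_integral_snd mu _ (fun p => gauss p.1 x' (phi p.2) * W p.2)) => //.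
    exact: measurable_kato_integrand.
  - by move=> s _; apply: integral_ge0 => z _; rewrite lee_fin.
  - by move=> s /=; rewrite !in_itv /= => /andP[-> st]; exact: lt_le_trans tT.
rewrite SE.
apply: (le_trans (bridge_integral_le mu phi W d2 mphi mW W0 gauss1 t _ x y t0 (fine_ge0 kato0) bound)).
rewrite -[in leRHS]KK -EFinM lee_fin le_eqVlt; apply/orP; left; apply/eqP.
by ring.
Qed.

End models.

Theorem theorem1p6 (R : realType) (d : nat) (hd : d = 1%N \/ d = 2%N) :
  exists c : R, 0 < c /\
    forall (T : R) (V : 'rV[R]_d -> R), 0 < T -> borel_fun V ->
      ((c^-1)%:E * Kato V T <= Snorm V T /\ Snorm V T <= c%:E * Kato V T)%E.
Proof.
(* The factor 4 is two halves of the bridge times the 2 of [bridge_le]; [expR 1] is the near region,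
   the remaining term the far one. *)
pose C : R := 4 * (expR 1 + 40 * pi * (expR 8^-1 * 64)).
(* This makes [C^-1 <= 1], so that a single constant serves both inequalities. *)
have C1 : 1 <= C.
  have e1 : 1 <= expR 1 :> R by apply: le_trans (expR_ge1Dx 1); rewrite lerDl.
  have : 0 <= 40 * pi * (expR 8^-1 * 64) :> R by rewrite !mulr_ge0 ?expR_ge0 ?pi_ge0.
  rewrite /C; lra.
have C0 : 0 < C by exact: lt_le_trans C1.
have bounds T V : 0 < T -> borel_fun V -> @Snorm_Kato_comparable R d T V.
  move: V; case: hd => -> V.
    apply: (Snorm_Kato_comparable_of_model lebesgue_measure point1) => //.
    - exact: measurable_point1.
    - exact: gauss_point1.
  move=> T0 bV.
  apply: (Snorm_Kato_comparable_of_model (sigma_finite_prod (@lebesgue_measure R) (@lebesgue_measure R))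
    point2 T V) => //; [exact: measurable_point2|exact: gauss_point2|].
  move=> f mf f0; rewrite intRd2E.
  have F0 p : (0 <= (f (point2 p))%:E)%E by rewrite lee_fin.
  have mF : measurable_fun setT (fun p => (f (point2 p))%:E) by exact/measurable_EFinP.
  exact/esym/(@fubini_tonelli1 _ _ _ _ _ (@lebesgue_measure R) (@lebesgue_measure R) _ mF F0).
exists C; split=> // T V T0 bV; have [K0 kS Sk] := bounds T V T0 bV.
split=> //; apply: le_trans kS; rewrite -[leRHS]mul1e; apply: lee_wpmul2r => //.
by rewrite lee_fin invf_le1.
Qed.
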